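(* Let $k\ge 1$ be an integer. The function $s\mapsto\zeta(s,\mathbb{CP}^k)$ has simple poles at $s=n$ for $n=1,2,\dots,k$, with residues $$\mathrm{Res}\bigl(\zeta(s,\mathbb{CP}^k),\,s=n\bigr)=\frac{1}{4^n}\,\frac{k}{[(k-1)!]^2}\,a_{k,n-1}.$$
   Context: For an integer $k\ge1$, $\zeta(s,\mathbb{CP}^k)$ denotes the function defined by $$\zeta(s,\mathbb{CP}^k)=\frac{1}{4^s}\sum_{n=1}^\infty\frac{Q_k(n)}{n^s(n+k)^s},\qquad Q_k(x)=\frac{k(2x+k)}{[(k-1)!]^2}\prod_{i=1}^{k-1}(x+i)^2,$$ for $\mathrm{Re}(s)>k$ (empty product $=1$), identified with its meromorphic continuation to $s\in\mathbb{C}$. The numbers $a_{k,l}$ are defined by the polynomial identity $$\prod_{i=1}^{k-1}(x+i)^2=\sum_{l=0}^{k-1}a_{k,l}\,(x^2+kx)^l.$$ *)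

(* Defs.v *)
(* Stdlib reals with Coquelicot's complex numbers. *)
From Stdlib Require Import Reals Factorial List Lia Lra Permutation.
From Coquelicot Require Import Coquelicot.
Open Scope R_scope.

(* The product over i = 1, ..., k - 1, equal to 1 when k = 1. *)
Definition prod_below (k : nat) (f : nat -> R) : R :=
  fold_right Rmult 1 (map f (seq 1 (k - 1))).

Definition Q (k : nat) (x : R) : R :=
  INR k * (2 * x + INR k) / (INR (fact (k - 1))) ^ 2
  * prod_below k (fun i => (x + INR i) ^ 2).

(* As functions on R determine polynomials, this fixes a 0, ..., a (k - 1) for
   k >= 1; the values a l with l >= k are irrelevant. *)
Definition is_CP_coeffs (k : nat) (a : nat -> R) : Prop :=
  forall x : R,
    prod_below k (fun i => (x + INR i) ^ 2)
    = sum_f_R0 (fun l => a l * (x ^ 2 + INR k * x) ^ l) (k - 1).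

Definition Cexp (z : C) : C :=
  (exp (Re z) * cos (Im z), exp (Re z) * sin (Im z)).

(* x^s with the real logarithm; meant for x > 0. *)
Definition cpowR (x : R) (s : C) : C := Cexp (s * RtoC (ln x))%C.

(* f (z) = sum_{j >= 0} c_j (z - z0)^(j - N) on a punctured disc around z0, so
   c_j is the Laurent coefficient of index j - N.  The value f z0 plays no
   role. *)
Definition laurent_at (f : C -> C) (z0 : C) (N : nat) (c : nat -> C) : Prop :=
  exists r : R, 0 < r /\
    forall z : C, 0 < Cmod (z - z0)%C < r ->
      is_series (V := C_NormedModule)
        (fun j : nat => (c j * (z - z0) ^ j / (z - z0) ^ N)%C) (f z).

(* Poles are automatically isolated, since near every point f is analytic off
   the point itself. *)
Definition meromorphic (f : C -> C) : Prop :=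
  forall z0 : C, exists (N : nat) (c : nat -> C), laurent_at f z0 N c.

Definition simple_pole (f : C -> C) (z0 : C) : Prop :=
  exists c : nat -> C, laurent_at f z0 1 c /\ c 0%nat <> RtoC 0.

(* The residue is the Laurent coefficient of index -1. *)
Definition is_residue (f : C -> C) (z0 : C) (rho : C) : Prop :=
  exists (N : nat) (c : nat -> C), laurent_at f z0 (S N) c /\ c N = rho.

(* The term with index m is the one for n = m + 1. *)
Definition zeta_CP_term (k : nat) (s : C) (m : nat) : C :=
  (RtoC (Q k (INR (S m)))
   / (cpowR (INR (S m)) s * cpowR (INR (S m) + INR k) s))%C.

Definition is_zeta_CP (k : nat) (zeta : C -> C) : Prop :=
  meromorphic zeta /\
  forall s : C, INR k < Re s ->
    exists S : C,
      is_series (V := C_NormedModule) (zeta_CP_term k s) S /\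
      zeta s = (1 / cpowR 4 s * S)%C.

Lemma prod_shift_poly (cs : list R) :
  exists a : nat -> R, forall y : R,
    fold_right Rmult 1 (map (fun c => y + c) cs)
    = sum_f_R0 (fun l => a l * y ^ l) (length cs).
Proof.
induction cs as [|c cs [a Ha]].
- exists (fun _ => 1); intros y; simpl; ring.
- set (b := fun l => if Nat.leb l (length cs) then a l else 0).
  exists (fun l => match l with O => c * b O | S l' => b l' + c * b l end).
  intros y; cbn [map fold_right length]; rewrite Ha.
  assert (Hb : sum_f_R0 (fun l => a l * y ^ l) (length cs)
               = sum_f_R0 (fun l => b l * y ^ l) (length cs)).
  { apply sum_eq; intros i Hi; unfold b.
    apply Nat.leb_le in Hi; rewrite Hi; reflexivity. }
  rewrite Hb.
  assert (Hz : b (S (length cs)) = 0).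
  { unfold b; replace (Nat.leb (S (length cs)) (length cs)) with false;
      [reflexivity|symmetry; apply Nat.leb_gt; lia]. }
  assert (H : forall m,
    sum_f_R0 (fun l => match l with O => c * b O | S l' => b l' + c * b l end
                       * y ^ l) (S m)
    = (y + c) * sum_f_R0 (fun l => b l * y ^ l) m + c * b (S m) * y ^ S m).
  { induction m as [|m IH]; [simpl; ring|].
    rewrite tech5, IH, (tech5 _ m); simpl; ring. }
  rewrite H, Hz; ring.
Qed.

Lemma CP_coeffs_exist (k : nat) : (1 <= k)%nat ->
  exists a : nat -> R, is_CP_coeffs k a.
Proof.
intros Hk.
destruct (prod_shift_poly
  (map (fun i => INR i * INR (k - i)) (seq 1 (k - 1)))) as [a Ha].
exists a; intros x; unfold prod_below.
rewrite length_map, length_seq in Ha; rewrite <- Ha, map_map.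
assert (Hmul : forall (f g : nat -> R) s,
  fold_right Rmult 1 (map (fun i => f i * g i) s)
  = fold_right Rmult 1 (map f s) * fold_right Rmult 1 (map g s)).
{ intros f g s; induction s as [|i s IH]; simpl; [ring|rewrite IH; ring]. }
assert (Hperm : forall s t : list R, Permutation s t ->
  fold_right Rmult 1 s = fold_right Rmult 1 t).
{ intros s t H; induction H; simpl; try lra; congruence. }
assert (Hrev : Permutation (map (fun i => (k - i)%nat) (seq 1 (k - 1)))
                           (seq 1 (k - 1))).
{ apply NoDup_Permutation_bis.
  - apply NoDup_map_NoDup_ForallPairs; [|apply seq_NoDup].
    intros i j Hi Hj; apply in_seq in Hi; apply in_seq in Hj; lia.
  - rewrite length_map; lia.
  - intros j Hj; apply in_map_iff in Hj; destruct Hj as [i [<- Hi]].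
    apply in_seq in Hi; apply in_seq; lia. }
transitivity (fold_right Rmult 1 (map (fun i => x + INR i) (seq 1 (k - 1)))
  * fold_right Rmult 1 (map (fun i => x + INR (k - i)) (seq 1 (k - 1)))).
- rewrite <- (map_map (fun i => (k - i)%nat) (fun i => x + INR i)).
  rewrite (Hperm _ _ (Permutation_map (fun i => x + INR i) Hrev)).
  rewrite <- Hmul; f_equal; apply map_ext; intros i; ring.
- rewrite <- Hmul; f_equal; apply map_ext_in; intros i Hi.
  apply in_seq in Hi; rewrite minus_INR by lia; ring.
Qed.

(* Main.v *)
(* Put g (x) = x (x + k) and F (w) = sum_{n >= 1} g' (n) g (n)^(-w). Since
   Q_k (n) = K g' (n) sum_l a_l g (n)^l with K = k / ((k - 1)!)^2, one has
   zeta (s) = 4^(-s) K sum_l a_l F (s - l), so it suffices to continue F to a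
   meromorphic function whose only pole is a simple one at 1 with residue 1.

   With y = n + k/2 and u = g (n) = y^2 - k^2/4, g (n -+ 1/2) = u + 1/4 -+ y.
   Telescoping g (n - 1/2)^(1 - w) - g (n + 1/2)^(1 - w) and expanding both powers
   by the binomial series around u gives, because (1/4 + y)^i - (1/4 - y)^i is
   2 y times a polynomial sum_a d_{i,a} u^a of degree at most (i - 1)/2 in u,
     F (w) = g (1/2)^(1 - w) / (w - 1)
             - sum_{2 <= i < J} beta_i (w) sum_a d_{i,a} F (w + i - 1 - a) - tail,
   where beta_i (w) = binom (1 - w, i) / (1 - w) and the tail is analytic for
   Re w > 1 - E when J = 2 E + 2. All shifts i - 1 - a are at least 1, so this
   continues F one strip at a time; the pole of F (w + m) at w = 1 - m is
   cancelled by the zero of beta_i there. The strips are glued, and an arbitrary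
   continuation is compared with this one, by the identity theorem along
   horizontal lines. The residues are nonzero because
   prod (x + i)^2 = prod (x^2 + k x + i (k - i)) has positive coefficients. *)
Require Import Defs.
From Stdlib Require Import Reals Factorial Arith List Permutation Lia Lra Classical IndefiniteDescription.
From Coquelicot Require Import Coquelicot.
Open Scope R_scope.

(* Coquelicot states some equalities at a structure's carrier, where ring and
   field do not apply. *)
Ltac eqR := match goal with |- @eq _ ?x ?y => change (@eq R x y) end.
Ltac eqC := match goal with |- @eq _ ?x ?y => change (@eq C x y) end.

(** The weight g' (n) is what makes the telescoping usable: 2 y u^(-w) is the first-order term of
    the difference, so F (w) itself comes out with coefficient 1 and the boundary value g (1/2)^(1 -
    w) / (w - 1) carries the whole pole at 1. Since y / u is of order 1/n, every further order of
    the expansion gains one power of n; for Re w > 1 - E the factor u^(1 - w) is at most of order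
    n^(2 E), so J = 2 E + 2 powers of the ratio leave terms of order n^(-2). This is the origin of
    J. The expansions have to converge already at n = 1: the ratio (1/4 + y) / u is largest for n =
    k = 1, where it is 7/8. Functions from C to C are total, so a continuation has arbitrary values
    at its poles; equalities between continuations are therefore stated on punctured discs. The
    identity theorem moves along a horizontal ray, where a supremum of reals replaces a
    connectedness argument in the plane and poles met on the way do no harm. *)

Lemma Re_RtoC (x : R) : Re (RtoC x) = x.
Proof. reflexivity. Qed.

(** * Complex series *)

Definition is_cseries (a : nat -> C) (l : C) : Prop :=
  is_series (V := C_NormedModule) a l.

Lemma is_cseries_eps (a : nat -> C) (l : C) :
  is_cseries a l <->
  forall eps : R, 0 < eps -> exists N, forall n, (N <= n)%nat ->
    Cmod (sum_n a n - l)%C < eps.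
Proof.
split.
- intros H eps Heps.
  apply (proj1 (filterlim_locally_ball_norm _ _)) with (eps := mkposreal eps Heps) in H.
  exact H.
- intros H; apply (proj2 (filterlim_locally_ball_norm _ _)); intros [eps Heps].
  exact (H eps Heps).
Qed.

Lemma is_cseries_unique (a : nat -> C) (l l' : C) :
  is_cseries a l -> is_cseries a l' -> l = l'.
Proof. intros H H'; exact (filterlim_locally_unique _ _ _ H H'). Qed.

Lemma is_cseries_ext (a b : nat -> C) (l : C) :
  (forall n, a n = b n) -> is_cseries a l -> is_cseries b l.
Proof. intros H Ha; exact (is_series_ext (V := C_NormedModule) a b l H Ha). Qed.

Lemma is_cseries_plus (a b : nat -> C) (la lb : C) :
  is_cseries a la -> is_cseries b lb ->
  is_cseries (fun n => a n + b n)%C (la + lb)%C.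
Proof. intros Ha Hb; exact (is_series_plus (V := C_NormedModule) a b la lb Ha Hb). Qed.

Lemma is_cseries_scal (c : C) (a : nat -> C) (l : C) :
  is_cseries a l -> is_cseries (fun n => c * a n)%C (c * l)%C.
Proof. intros Ha; exact (is_series_scal (V := C_NormedModule) c a l Ha). Qed.

Lemma is_cseries_minus (a b : nat -> C) (la lb : C) :
  is_cseries a la -> is_cseries b lb ->
  is_cseries (fun n => a n - b n)%C (la - lb)%C.
Proof. intros Ha Hb; exact (is_series_minus (V := C_NormedModule) a b la lb Ha Hb). Qed.

Lemma is_cseries_S (a : nat -> C) (l : C) :
  is_cseries (fun n => a (S n)) (l - a O)%C <-> is_cseries a l.
Proof.
split; intros H.
- exact (is_series_decr_1 (V := C_NormedModule) a l H).
- apply (is_series_incr_1 (V := C_NormedModule) a); change plus with Cplus.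
  replace (l - a O + a O)%C with l by ring; exact H.
Qed.

Lemma is_cseries_shift (a : nat -> C) (l : C) (m : nat) :
  is_cseries (fun n => a (S m + n)%nat) (l - sum_n a m)%C <-> is_cseries a l.
Proof.
split; intros H.
- exact (is_series_decr_n (V := C_NormedModule) a (S m) l (Nat.lt_0_succ m) H).
- apply (is_series_incr_n (V := C_NormedModule) a (S m)); [lia|]; change plus with Cplus.
  refine (eq_rect l (fun x => is_series (V := C_NormedModule) a x) H _ _).
  assert (E : forall x : C, l = (l - x + x)%C) by (intros; ring); apply E.
Qed.

Lemma sum_n_SC (a : nat -> C) (n : nat) :
  sum_n a (S n) = (sum_n a n + a (S n))%C.
Proof. apply (sum_Sn a). Qed.

Lemma sum_n_SR (a : nat -> R) (n : nat) : sum_n a (S n) = sum_n a n + a (S n).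
Proof. apply (sum_Sn a). Qed.

Lemma sum_n_OC (a : nat -> C) : sum_n a O = a O.
Proof. apply (sum_O a). Qed.

Lemma sum_n_OR (a : nat -> R) : sum_n a O = a O.
Proof. apply (sum_O a). Qed.

Lemma is_cseries_sum_n (a : nat -> nat -> C) (l : nat -> C) (J : nat) :
  (forall j, (j <= J)%nat -> is_cseries (fun n => a n j) (l j)) ->
  is_cseries (fun n => sum_n (a n) J) (sum_n l J).
Proof.
intros H; induction J as [|J IH].
- rewrite sum_n_OC; apply is_cseries_ext with (2 := H O (Nat.le_refl 0)).
  intros n; rewrite sum_n_OC; reflexivity.
- rewrite sum_n_SC; apply is_cseries_ext with
    (2 := is_cseries_plus _ _ _ _ (IH (fun j Hj => H j ltac:(lia))) (H (S J) (Nat.le_refl _))).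
  intros n; rewrite sum_n_SC; reflexivity.
Qed.

Lemma is_series_sum_n (a : nat -> nat -> R) (l : nat -> R) (J : nat) :
  (forall j, is_series (fun n => a n j) (l j)) ->
  is_series (fun n => sum_n (a n) J) (sum_n l J).
Proof.
intros H; induction J as [|J IH].
- rewrite sum_n_OR; apply is_series_ext with (2 := H O).
  intros n; rewrite sum_n_OR; reflexivity.
- rewrite sum_n_SR; apply is_series_ext with (2 := is_series_plus _ _ _ _ IH (H (S J))).
  intros n; rewrite sum_n_SR; reflexivity.
Qed.

Lemma Cmod_sum_n (a : nat -> C) (b : nat -> R) (n : nat) :
  (forall j, Cmod (a j) <= b j) -> Cmod (sum_n a n) <= sum_n b n.
Proof.
intros H; induction n as [|n IH].
- rewrite sum_n_OC, sum_n_OR; apply H.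
- rewrite sum_n_SC, sum_n_SR; eapply Rle_trans; [apply Cmod_triangle|].
  apply Rplus_le_compat; auto.
Qed.

Lemma sum_n_incr (b : nat -> R) (n m : nat) :
  (forall j, 0 <= b j) -> (n <= m)%nat -> sum_n b n <= sum_n b m.
Proof.
intros H Hnm; induction Hnm as [|m Hm IH]; [lra|].
rewrite sum_n_SR; specialize (H (S m)); lra.
Qed.

Lemma is_series_eps (a : nat -> R) (l : R) :
  is_series a l <->
  forall eps : R, 0 < eps -> exists N, forall n, (N <= n)%nat ->
    Rabs (sum_n a n - l) < eps.
Proof.
split.
- intros H eps Heps.
  apply (proj1 (filterlim_locally_ball_norm _ _)) with (eps := mkposreal eps Heps) in H.
  exact H.
- intros H; apply (proj2 (filterlim_locally_ball_norm _ _)); intros [eps Heps].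
  exact (H eps Heps).
Qed.

Lemma sum_n_le_series (b : nat -> R) (l : R) (n : nat) :
  (forall j, 0 <= b j) -> is_series b l -> sum_n b n <= l.
Proof.
intros Hb H; apply Rnot_lt_le; intros Hlt.
destruct (proj1 (is_series_eps _ _) H (sum_n b n - l)) as [N HN]; [lra|].
specialize (HN (max n N) ltac:(lia)).
pose proof (sum_n_incr b n (max n N) Hb ltac:(lia)).
apply Rabs_def2 in HN; lra.
Qed.

Lemma is_series_bound (b : nat -> R) (l M : R) :
  is_series b l -> (forall n, sum_n b n <= M) -> l <= M.
Proof.
intros H HM; apply Rnot_lt_le; intros Hlt.
destruct (proj1 (is_series_eps _ _) H (l - M)) as [N HN]; [lra|].
specialize (HN N ltac:(lia)); specialize (HM N).
apply Rabs_def2 in HN; lra.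
Qed.

Lemma series_pos_bounded (b : nat -> R) (M : R) :
  (forall j, 0 <= b j) -> (forall n, sum_n b n <= M) ->
  exists l : R, is_series b l /\ l <= M.
Proof.
intros Hb HM.
destruct (ex_finite_lim_seq_incr (sum_n b) M) as [l Hl]; [|exact HM|].
{ intros n; apply sum_n_incr; auto. }
assert (H : is_series b l) by exact Hl.
exists l; split; [exact H|]; eapply is_series_bound; eauto.
Qed.

Lemma series_dominated (a b : nat -> R) (l : R) :
  (forall n, 0 <= a n <= b n) -> is_series b l ->
  exists l', is_series a l' /\ l' <= l.
Proof.
intros H Hb; apply series_pos_bounded; [intros j; apply H|].
intros n; apply Rle_trans with (sum_n b n).
- apply sum_n_m_le; intros j; apply H.
- apply sum_n_le_series; auto; intros j; specialize (H j); lra.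
Qed.

Lemma cseries_dominated (a : nat -> C) (b : nat -> R) (B : R) :
  (forall n, Cmod (a n) <= b n) -> is_series b B ->
  exists l, is_cseries a l /\ Cmod l <= B.
Proof.
intros H Hb.
assert (Hex : exists l : C, is_cseries a l).
{ destruct (ex_series_le (V := C_CompleteNormedModule) a b H) as [l Hl];
    [exists B; exact Hb|exists l; exact Hl]. }
destruct Hex as [l Hl]; exists l; split; [exact Hl|].
apply Rnot_lt_le; intros Hlt.
destruct (proj1 (is_cseries_eps _ _) Hl (Cmod l - B)) as [N HN]; [lra|].
specialize (HN N ltac:(lia)).
pose proof (Cmod_sum_n a b N H).
assert (sum_n b N <= B).
{ apply sum_n_le_series; auto.
  intros j; eapply Rle_trans; [apply Cmod_ge_0|apply H]. }
pose proof (Cmod_triangle (sum_n a N) (-(sum_n a N - l))%C) as Ht.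
rewrite Cmod_opp in Ht.
replace (sum_n a N + - (sum_n a N - l))%C with l in Ht by ring; lra.
Qed.

Lemma cseries_tail_bound (a : nat -> C) (b : nat -> R) (l : C) (B : R) (N : nat) :
  (forall n, Cmod (a n) <= b n) -> is_series b B -> is_cseries a l ->
  Cmod (l - sum_n a N)%C <= B - sum_n b N.
Proof.
intros H Hb Ha.
assert (Hb' : is_series (fun n => b (S N + n)%nat) (B - sum_n b N)).
{ apply (is_series_incr_n b (S N)); [lia|]; change plus with Rplus.
  refine (eq_rect B (fun x => is_series b x) Hb _ _).
  assert (E : forall x : R, B = B - x + x) by (intros; ring); apply E. }
apply (is_cseries_shift a l N) in Ha.
destruct (cseries_dominated (fun n => a (S N + n)%nat) _ _ (fun n => H _) Hb')
  as [l' [Hl' Hle]].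
rewrite (is_cseries_unique _ _ _ Ha Hl'); exact Hle.
Qed.

(** Dominated convergence for series: beyond N the sum is bounded by the tail of [B], and the first
    N terms are finitely many null sequences. Each part is made at most eps / 3. *)
Lemma series_tannery (d : nat -> nat -> R) (B : nat -> R) (S0 : R) :
  (forall J n, 0 <= d J n <= B n) -> is_series B S0 ->
  (forall n eps, 0 < eps -> exists J0, forall J, (J0 <= J)%nat -> d J n < eps) ->
  forall eps, 0 < eps -> exists J0, forall J L, (J0 <= J)%nat ->
    is_series (d J) L -> L < eps.
Proof.
intros Hd HB Hlim eps Heps.
assert (HB0 : forall j, 0 <= B j) by (intros j; specialize (Hd O j); lra).
destruct (proj1 (is_series_eps _ _) HB (eps / 3)) as [N HN]; [lra|].
specialize (HN N ltac:(lia)); apply Rabs_def2 in HN.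
assert (Hfin : forall M e, 0 < e -> exists J0, forall J, (J0 <= J)%nat ->
  sum_n (d J) M < e).
{ induction M as [|M IH]; intros e He.
  - destruct (Hlim O e He) as [J0 HJ]; exists J0; intros J HJJ.
    rewrite sum_n_OR; auto.
  - destruct (IH (e / 2)) as [J1 H1]; [lra|].
    destruct (Hlim (S M) (e / 2)) as [J2 H2]; [lra|].
    exists (max J1 J2); intros J HJ; rewrite sum_n_SR.
    specialize (H1 J ltac:(lia)); specialize (H2 J ltac:(lia)); lra. }
destruct (Hfin N (eps / 3)) as [J0 HJ0]; [lra|].
exists J0; intros J L HJ HL; specialize (HJ0 J HJ).
assert (L <= eps / 3 + eps / 3); [|lra].
apply is_series_bound with (1 := HL); intros n.
assert (Hn : forall p, sum_n (d J) (N + p) <= sum_n (d J) N + (sum_n B (N + p) - sum_n B N)).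
{ induction p as [|p IH]; [rewrite Nat.add_0_r; lra|].
  rewrite Nat.add_succ_r, !sum_n_SR; specialize (Hd J (S (N + p))); lra. }
pose proof (sum_n_incr (d J) n (N + n) (fun j => proj1 (Hd J j)) ltac:(lia)).
specialize (Hn n).
pose proof (sum_n_le_series B S0 (N + n) HB0 HB); lra.
Qed.

(** Interchange of the two summations. Tannery is applied to the row remainders
    [t n - sum_n (a n) J], which are dominated by [B n] and tend to 0 as J grows. The bound on the
    absolute sum of the column sums [s] is what later bounds the norm of a sum of power series. *)
Lemma cseries_fubini (a : nat -> nat -> C) (A B : nat -> R) (S0 : R) (t : nat -> C) :
  (forall n, is_series (fun j => Cmod (a n j)) (A n)) ->
  (forall n, A n <= B n) -> is_series B S0 ->
  (forall n, is_cseries (a n) (t n)) ->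
  exists s : nat -> C,
    (forall j, is_cseries (fun n => a n j) (s j)) /\
    (exists L : R, is_series (fun j => Cmod (s j)) L /\ L <= S0) /\
    exists T, is_cseries t T /\ is_cseries s T.
Proof.
intros HA HAB HB Ht.
assert (Hpart : forall n J, sum_n (fun j => Cmod (a n j)) J <= A n).
{ intros n J; apply sum_n_le_series; [intros j; apply Cmod_ge_0|apply HA]. }
assert (Hone : forall n j, Cmod (a n j) <= B n).
{ intros n j; specialize (HAB n); specialize (Hpart n j).
  destruct j as [|j]; [rewrite sum_n_OR in Hpart; lra|].
  rewrite sum_n_SR in Hpart.
  assert (0 <= sum_n (fun j => Cmod (a n j)) j); [|lra].
  apply Rle_trans with (sum_n (fun j => Cmod (a n j)) O).
  - rewrite sum_n_OR; apply Cmod_ge_0.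
  - apply sum_n_incr; [intros; apply Cmod_ge_0|lia]. }
destruct (functional_choice (fun j s => is_cseries (fun n => a n j) s)) as [s Hs].
{ intros j; destruct (cseries_dominated (fun n => a n j) B S0) as [l [Hl _]]; eauto. }
destruct (functional_choice (fun j s => is_series (fun n => Cmod (a n j)) s)) as [sg Hsg].
{ intros j; destruct (series_dominated (fun n => Cmod (a n j)) B S0) as [l [Hl _]]; eauto.
  intros n; split; [apply Cmod_ge_0|apply Hone]. }
exists s; split; [exact Hs|split].
- apply series_pos_bounded; [intros j; apply Cmod_ge_0|]; intros J.
  apply Rle_trans with (sum_n sg J).
  + apply sum_n_m_le; intros j.
    destruct (cseries_dominated (fun n => a n j) _ _ (fun n => Rle_refl _) (Hsg j))
      as [l [Hl Hle]].
    rewrite (is_cseries_unique _ _ _ (Hs j) Hl); exact Hle.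
  + destruct (series_dominated (fun n => sum_n (fun j => Cmod (a n j)) J) B S0)
      as [l [Hl Hle]]; [|exact HB|].
    { intros n; split; [|specialize (Hpart n J); specialize (HAB n); lra].
      apply Rle_trans with (sum_n (fun j => Cmod (a n j)) O).
      - rewrite sum_n_OR; apply Cmod_ge_0.
      - apply sum_n_incr; [intros; apply Cmod_ge_0|lia]. }
    pose proof (is_series_sum_n (fun n j => Cmod (a n j)) sg J Hsg) as H.
    assert (E : sum_n sg J = l).
    { etransitivity; [symmetry; exact (is_series_unique _ _ H)|].
      exact (is_series_unique _ _ Hl). }
    rewrite E; exact Hle.
- assert (HtB : forall n, Cmod (t n) <= B n).
  { intros n.
    destruct (cseries_dominated (a n) _ _ (fun n => Rle_refl _) (HA n)) as [l [Hl Hle]].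
    rewrite (is_cseries_unique _ _ _ (Ht n) Hl); specialize (HAB n); lra. }
  destruct (cseries_dominated t B S0 HtB HB) as [T [HT _]].
  exists T; split; [exact HT|].
  apply is_cseries_eps; intros eps Heps.
  assert (Hd : forall J n, 0 <= Cmod (t n - sum_n (a n) J)%C <= B n).
  { intros J n; split; [apply Cmod_ge_0|].
    pose proof (cseries_tail_bound (a n) _ (t n) (A n) J (fun n => Rle_refl _) (HA n) (Ht n)) as H.
    assert (0 <= sum_n (fun j => Cmod (a n j)) J).
    { apply Rle_trans with (sum_n (fun j => Cmod (a n j)) O).
      - rewrite sum_n_OR; apply Cmod_ge_0.
      - apply sum_n_incr; [intros; apply Cmod_ge_0|lia]. }
    specialize (HAB n); lra. }
  destruct (series_tannery (fun J n => Cmod (t n - sum_n (a n) J)%C) B S0 Hd HB)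
    with (eps := eps) as [J0 HJ0]; [|exact Heps|].
  { intros n e He; destruct (proj1 (is_cseries_eps _ _) (Ht n) e He) as [J0 HJ].
    exists J0; intros J HJJ; rewrite <- Cmod_opp.
    replace (- (t n - sum_n (a n) J))%C with (sum_n (a n) J - t n)%C by ring; auto. }
  exists J0; intros J HJ.
  pose proof (is_cseries_minus _ _ _ _ HT (is_cseries_sum_n a s J (fun j _ => Hs j))) as H.
  destruct (series_dominated (fun n => Cmod (t n - sum_n (a n) J)%C) B S0 (Hd J) HB)
    as [L [HL _]].
  destruct (cseries_dominated _ _ _ (fun n => Rle_refl _) HL) as [l [Hl Hle]].
  specialize (HJ0 J L HJ HL).
  rewrite (is_cseries_unique _ _ _ Hl H) in Hle.
  rewrite <- Cmod_opp.
  replace (- (sum_n s J - T))%C with (T - sum_n s J)%C by ring; lra.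
Qed.

(** * The exponential and binomial series *)

Lemma Re_sum_n (a : nat -> C) (n : nat) : Re (sum_n a n) = sum_n (fun j => Re (a j)) n.
Proof.
induction n as [|n IH]; [rewrite sum_n_OC, sum_n_OR; reflexivity|].
rewrite sum_n_SC, sum_n_SR, re_plus, IH; reflexivity.
Qed.

Lemma Im_sum_n (a : nat -> C) (n : nat) : Im (sum_n a n) = sum_n (fun j => Im (a j)) n.
Proof.
induction n as [|n IH]; [rewrite sum_n_OC, sum_n_OR; reflexivity|].
rewrite sum_n_SC, sum_n_SR, im_plus, IH; reflexivity.
Qed.

Lemma Cmod_le_Re_Im (z : C) : Cmod z <= Rabs (Re z) + Rabs (Im z).
Proof.
destruct z as [x y].
replace ((x, y) : C) with (RtoC x + Ci * RtoC y)%C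
  by (apply injective_projections; simpl; ring).
eapply Rle_trans; [apply Cmod_triangle|].
rewrite Cmod_mult, Cmod_Ci, !Cmod_R; simpl.
replace (x + (0 * y - 1 * 0)) with x by ring.
replace (0 + (0 * 0 + 1 * y)) with y by ring; lra.
Qed.

Lemma is_cseries_Re_Im (a : nat -> C) (l : C) :
  is_series (fun n => Re (a n)) (Re l) -> is_series (fun n => Im (a n)) (Im l) ->
  is_cseries a l.
Proof.
intros H1 H2; apply is_cseries_eps; intros eps Heps.
destruct (proj1 (is_series_eps _ _) H1 (eps / 2)) as [N1 HN1]; [lra|].
destruct (proj1 (is_series_eps _ _) H2 (eps / 2)) as [N2 HN2]; [lra|].
exists (max N1 N2); intros n Hn.
specialize (HN1 n ltac:(lia)); specialize (HN2 n ltac:(lia)).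
eapply Rle_lt_trans; [apply Cmod_le_Re_Im|].
unfold Cminus; rewrite re_plus, im_plus, re_opp, im_opp, Re_sum_n, Im_sum_n.
unfold Rminus in *; lra.
Qed.

(** For f = p + i q the hypothesis is f' = al G' f. [X] and [Y] are the real and imaginary parts of
    f exp (- al G), whose derivative vanishes. The interval is written with [Rmin] and [Rmax]
    because T may be negative. *)
Lemma cexp_ode (p q G g : R -> R) (al : C) (T : R) :
  (forall t, Rmin 0 T <= t <= Rmax 0 T ->
    is_derive G t (g t) /\
    is_derive p t (g t * (Re al * p t - Im al * q t)) /\
    is_derive q t (g t * (Im al * p t + Re al * q t))) ->
  G 0 = 0 -> p 0 = 1 -> q 0 = 0 -> (p T, q T) = Cexp (al * RtoC (G T))%C.
Proof.
intros H HG Hp Hq; destruct al as [a b]; unfold Cexp.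
rewrite re_scal_r, im_scal_r; simpl in *.
set (X := fun t => exp (- (a * G t)) * (p t * cos (b * G t) + q t * sin (b * G t))).
set (Y := fun t => exp (- (a * G t)) * (q t * cos (b * G t) - p t * sin (b * G t))).
assert (HX : forall t, Rmin 0 T <= t <= Rmax 0 T -> is_derive X t zero).
{ intros t Ht; destruct (H t Ht) as [H1 [H2 H3]].
  assert (D1 : Derive (fun x : R => G x) t = _) by exact (is_derive_unique _ _ _ H1).
  assert (D2 : Derive (fun x : R => p x) t = _) by exact (is_derive_unique _ _ _ H2).
  assert (D3 : Derive (fun x : R => q x) t = _) by exact (is_derive_unique _ _ _ H3).
  unfold X.
  auto_derive.
  - repeat split; first [exists (g t); exact H1 | eexists; exact H2 | eexists; exact H3].
  - rewrite D1, D2, D3; unfold zero; simpl; ring. }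
assert (HY : forall t, Rmin 0 T <= t <= Rmax 0 T -> is_derive Y t zero).
{ intros t Ht; destruct (H t Ht) as [H1 [H2 H3]].
  assert (D1 : Derive (fun x : R => G x) t = _) by exact (is_derive_unique _ _ _ H1).
  assert (D2 : Derive (fun x : R => p x) t = _) by exact (is_derive_unique _ _ _ H2).
  assert (D3 : Derive (fun x : R => q x) t = _) by exact (is_derive_unique _ _ _ H3).
  unfold Y.
  auto_derive.
  - repeat split; first [exists (g t); exact H1 | eexists; exact H2 | eexists; exact H3].
  - rewrite D1, D2, D3; unfold zero; simpl; ring. }
assert (Hc : forall F : R -> R,
  (forall t, Rmin 0 T <= t <= Rmax 0 T -> is_derive F t zero) -> F T = F 0).
{ intros F HF; destruct (Rtotal_order T 0) as [HT|[->|HT]]; [|reflexivity|].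
  - apply eq_is_derive; [|exact HT]; intros t Ht; apply HF.
    rewrite Rmin_right, Rmax_left by lra; exact Ht.
  - symmetry; apply eq_is_derive; [|exact HT]; intros t Ht; apply HF.
    rewrite Rmin_left, Rmax_right by lra; exact Ht. }
apply Hc in HX; apply Hc in HY; unfold X, Y in HX, HY.
rewrite HG, Hp, Hq, !Rmult_0_r, Ropp_0, exp_0, cos_0, sin_0 in HX, HY.
rewrite exp_Ropp in HX, HY.
pose proof (exp_pos (a * G T)) as He.
pose proof (sin2_cos2 (b * G T)) as Hsc; unfold Rsqr in Hsc.
set (e := exp (a * G T)) in *; set (cc := cos (b * G T)) in *; set (ss := sin (b * G T)) in *.
assert (E1 : p T * cc + q T * ss = e).
{ apply Rmult_eq_reg_l with (/ e); [rewrite HX; field; lra|].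
  apply Rinv_neq_0_compat; lra. }
assert (E2 : q T * cc - p T * ss = 0).
{ apply Rmult_eq_reg_l with (/ e); [rewrite HY; ring|].
  apply Rinv_neq_0_compat; lra. }
f_equal.
- transitivity (p T * (ss * ss + cc * cc)); [rewrite Hsc; ring|].
  transitivity ((p T * cc + q T * ss) * cc - (q T * cc - p T * ss) * ss); [ring|].
  rewrite E1, E2; ring.
- transitivity (q T * (ss * ss + cc * cc)); [rewrite Hsc; ring|].
  transitivity ((p T * cc + q T * ss) * ss + (q T * cc - p T * ss) * cc); [ring|].
  rewrite E1, E2; ring.
Qed.

Lemma CV_radius_lower_bound (a : nat -> R) (rho M t : R) :
  (forall j, Rabs (a j) * rho ^ j <= M) -> Rabs t < rho ->
  Rbar_lt (Rabs t) (CV_radius a).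
Proof.
intros H Ht; apply Rbar_lt_le_trans with rho; [exact Ht|].
apply (proj1 (CV_radius_bounded a)); exists M; intros n.
rewrite Rabs_mult, (Rabs_pos_eq (rho ^ n)); [apply H|].
apply pow_le; pose proof (Rabs_pos t); lra.
Qed.

(* The recurrence says that f (t) = sum c_j t^j satisfies (1 + e t) f' = al f. *)
Lemma power_series_cexp (c : nat -> C) (al : C) (e rho M : R) (G : R -> R) :
  (forall j, Cmod (c j) * rho ^ j <= M) ->
  c O = RtoC 1 ->
  (forall j, RtoC (INR (S j)) * c (S j) + RtoC (e * INR j) * c j = al * c j)%C ->
  G 0 = 0 ->
  (forall t, Rabs t < rho -> 1 + e * t <> 0 /\ is_derive G t (/ (1 + e * t))) ->
  forall t, Rabs t < rho ->
    is_cseries (fun j => c j * RtoC t ^ j)%C (Cexp (al * RtoC (G t)))%C.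
Proof.
intros HM H0 Hrec HG HG' T HT.
set (a := fun j => Re (c j)); set (b := fun j => Im (c j)).
assert (Hrho : 0 <= rho) by (pose proof (Rabs_pos T); lra).
assert (Ha : forall t, Rabs t < rho -> Rbar_lt (Rabs t) (CV_radius a)).
{ intros t Ht; apply CV_radius_lower_bound with rho M; [|exact Ht]; intros j.
  eapply Rle_trans; [|apply (HM j)].
  apply Rmult_le_compat_r; [apply pow_le, Hrho|apply re_le_Cmod]. }
assert (Hb : forall t, Rabs t < rho -> Rbar_lt (Rabs t) (CV_radius b)).
{ intros t Ht; apply CV_radius_lower_bound with rho M; [|exact Ht]; intros j.
  eapply Rle_trans; [|apply (HM j)].
  apply Rmult_le_compat_r; [apply pow_le, Hrho|].
  eapply Rle_trans; [|apply Rmax_Cmod]; apply Rmax_r. }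
(* [h] lists the coefficients of (1 + e t) f', so f' is [PSeries h] divided by 1 + e t. This is used
   for the real and imaginary parts separately, with [h] the corresponding part of al c. *)
assert (Hder : forall f h : nat -> R, (forall j,
    PS_plus (PS_derive f) (PS_incr_1 (PS_scal e (PS_derive f))) j = h j) ->
    forall t, Rbar_lt (Rabs t) (CV_radius f) -> 1 + e * t <> 0 ->
    is_derive (PSeries f) t (/ (1 + e * t) * PSeries h t)).
{ intros f h Hh t Ht Het.
  rewrite <- (PSeries_ext _ _ t Hh).
  assert (Hex : ex_pseries (PS_derive f) t) by (apply ex_pseries_derive; exact Ht).
  rewrite PSeries_plus, PSeries_incr_1, PSeries_scal;
    [|exact Hex|apply ex_pseries_incr_1, ex_pseries_scal; [apply Rmult_comm|exact Hex]].
  replace (/ (1 + e * t) * (PSeries (PS_derive f) t + t * (e * PSeries (PS_derive f) t)))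
    with (PSeries (PS_derive f) t) by (field; exact Het).
  apply is_derive_PSeries; exact Ht. }
assert (E : (PSeries a T, PSeries b T) = Cexp (al * RtoC (G T))%C).
{ apply cexp_ode with (g := fun t => / (1 + e * t)); [|exact HG| |].
  - intros t Ht0.
    assert (Ht : Rabs t < rho).
    { unfold Rmin, Rmax in Ht0; apply Rabs_def2 in HT; apply Rabs_def1;
        destruct (Rle_dec 0 T); lra. }
    destruct (HG' t Ht) as [Hne HGt]; split; [exact HGt|split].
    + replace (Re al * PSeries a t - Im al * PSeries b t)
        with (PSeries (PS_plus (PS_scal (Re al) a) (PS_scal (- Im al) b)) t).
      * apply Hder; [|apply Ha, Ht|exact Hne].
        intros j; specialize (Hrec j); apply (f_equal Re) in Hrec.
        rewrite re_plus, !re_scal_l, re_mult in Hrec.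
        unfold PS_plus, PS_scal, PS_incr_1, PS_derive, a, b.
        change plus with Rplus; change scal with Rmult.
        rewrite <- Ropp_mult_distr_l; unfold Rminus in Hrec; rewrite <- Hrec.
        eqR.
        destruct j; [change (@zero _) with 0; simpl; ring|ring].
      * rewrite PSeries_plus, !PSeries_scal; [ring| |];
          apply ex_pseries_scal; try apply Rmult_comm; apply CV_radius_inside; auto.
    + replace (Im al * PSeries a t + Re al * PSeries b t)
        with (PSeries (PS_plus (PS_scal (Im al) a) (PS_scal (Re al) b)) t).
      * apply Hder; [|apply Hb, Ht|exact Hne].
        intros j; specialize (Hrec j); apply (f_equal Im) in Hrec.
        rewrite im_plus, !im_scal_l, im_mult in Hrec.
        unfold PS_plus, PS_scal, PS_incr_1, PS_derive, a, b.
        change plus with Rplus; change scal with Rmult.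
        rewrite (Rplus_comm (Im al * _)), <- Hrec.
        eqR.
        destruct j; [change (@zero _) with 0; simpl; ring|ring].
      * rewrite PSeries_plus, !PSeries_scal; [ring| |];
          apply ex_pseries_scal; try apply Rmult_comm; apply CV_radius_inside; auto.
  - rewrite PSeries_0; unfold a; rewrite H0; reflexivity.
  - rewrite PSeries_0; unfold b; rewrite H0; reflexivity. }
rewrite <- E; apply is_cseries_Re_Im.
- apply is_series_ext with (fun n => a n * T ^ n).
  { intros n; rewrite <- RtoC_pow, re_scal_r; reflexivity. }
  apply is_pseries_R, PSeries_correct, CV_radius_inside, Ha, HT.
- apply is_series_ext with (fun n => b n * T ^ n).
  { intros n; rewrite <- RtoC_pow, im_scal_r; reflexivity. }
  apply is_pseries_R, PSeries_correct, CV_radius_inside, Hb, HT.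
Qed.

(** The case e = 0 of the differential equation, f' = z f, evaluated at t = 1. The choice rho = 2
    keeps 1 inside the disc, and |z|^j 2^j / j! is a single term of the series of exp (2 |z|). *)
Lemma Cexp_series (z : C) :
  is_cseries (fun j => RtoC (/ INR (fact j)) * z ^ j)%C (Cexp z).
Proof.
set (c := fun j => (RtoC (/ INR (fact j)) * z ^ j)%C).
assert (H : is_cseries (fun j => c j * RtoC 1 ^ j)%C (Cexp (z * RtoC 1))).
{ apply power_series_cexp with (e := 0) (rho := 2) (M := exp (2 * Cmod z)) (G := fun t => t).
  - intros j; unfold c; rewrite Cmod_mult, Cmod_R, Cmod_pow, Rabs_pos_eq;
      [|left; apply Rinv_0_lt_compat, INR_fact_lt_0].
    rewrite Rmult_assoc, <- Rpow_mult_distr, (Rmult_comm (Cmod z)).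
    set (f := fun n => / INR (fact n) * (2 * Cmod z) ^ n).
    assert (Hf : forall n, 0 <= f n).
    { intros n; apply Rmult_le_pos; [left; apply Rinv_0_lt_compat, INR_fact_lt_0|].
      apply pow_le; pose proof (Cmod_ge_0 z); lra. }
    apply Rle_trans with (sum_n f j).
    + destruct j; [rewrite sum_n_OR; apply Rle_refl|]; rewrite sum_n_SR.
      pose proof (sum_n_incr f O j Hf ltac:(lia)) as H; rewrite sum_n_OR in H.
      specialize (Hf O); fold (f (S j)); lra.
    + apply sum_n_le_series; [exact Hf|].
      exact (proj1 (is_pseries_R _ _ _) (is_exp_Reals _)).
  - unfold c; simpl; rewrite Rinv_1; ring.
  - intros j; unfold c.
    replace (fact (S j)) with (S j * fact j)%nat by reflexivity.
    rewrite mult_INR, Rinv_mult, RtoC_mult, Cpow_S.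
    assert (E : (RtoC (INR (S j)) * RtoC (/ INR (S j)))%C = RtoC 1).
    { rewrite <- RtoC_mult; f_equal; field; apply not_0_INR; lia. }
    rewrite Rmult_0_l.
    transitivity (RtoC (INR (S j)) * RtoC (/ INR (S j))
      * (z * (RtoC (/ INR (fact j)) * z ^ j)))%C; [ring|rewrite E; ring].
  - reflexivity.
  - intros t _; split; [lra|]; auto_derive; [exact I|field].
  - rewrite Rabs_R1; lra. }
rewrite Cmult_1_r in H; apply is_cseries_ext with (2 := H).
intros n; rewrite Cpow_1_l; unfold c; ring.
Qed.

Fixpoint cbinom (al : C) (j : nat) : C :=
  match j with
  | O => RtoC 1
  | S i => (cbinom al i * ((al - RtoC (INR i)) / RtoC (INR (S i))))%C
  end.

(** This is |binom (- r, j)|, the rising factorial of r divided by j!. It bounds |binom (al, j)| for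
    all |al| <= r at once. *)
Fixpoint binom_majorant (r : R) (j : nat) : R :=
  match j with
  | O => 1
  | S i => binom_majorant r i * ((r + INR i) / INR (S i))
  end.

Lemma binom_majorant_pos (r : R) (j : nat) : 0 < r -> 0 < binom_majorant r j.
Proof.
intros Hr; induction j as [|j IH]; [simpl; lra|].
cbn [binom_majorant]; apply Rmult_lt_0_compat; [exact IH|].
apply Rdiv_lt_0_compat; [pose proof (pos_INR j); lra|apply lt_0_INR; lia].
Qed.

Lemma cbinom_le (al : C) (r : R) (j : nat) :
  Cmod al <= r -> Cmod (cbinom al j) <= binom_majorant r j.
Proof.
intros Hr; induction j as [|j IH].
- simpl; rewrite Cmod_1; lra.
- cbn [cbinom binom_majorant].
  assert (Hj : RtoC (INR (S j)) <> RtoC 0)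
    by (intros E; apply RtoC_inj in E; revert E; apply not_0_INR; lia).
  rewrite Cmod_mult, Cmod_div, !Cmod_R by exact Hj.
  rewrite (Rabs_pos_eq (INR (S j))) by apply pos_INR.
  apply Rmult_le_compat; [apply Cmod_ge_0| |exact IH|].
  + apply Rmult_le_pos; [apply Cmod_ge_0|left; apply Rinv_0_lt_compat, lt_0_INR; lia].
  + apply Rmult_le_compat_r; [left; apply Rinv_0_lt_compat, lt_0_INR; lia|].
    unfold Cminus; eapply Rle_trans; [apply Cmod_triangle|].
    rewrite Cmod_opp, Cmod_R, Rabs_pos_eq by apply pos_INR; lra.
Qed.

Lemma binom_majorant_summable (r x : R) :
  0 < r -> 0 <= x < 1 -> exists l : R, is_series (fun j => binom_majorant r j * x ^ j) l.
Proof.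
intros Hr Hx.
assert (E : CV_radius (binom_majorant r) = / 1).
{ apply CV_radius_finite_DAlembert; [|lra|].
  - intros n; pose proof (binom_majorant_pos r n Hr); lra.
  - apply is_lim_seq_ext with (fun n => 1 + (r - 1) * / INR (S n)).
    + intros n; pose proof (binom_majorant_pos r n Hr); cbn [binom_majorant].
      assert (0 < INR (S n)) by (apply lt_0_INR; lia).
      replace (binom_majorant r n * ((r + INR n) / INR (S n)) / binom_majorant r n)
        with ((r + INR n) / INR (S n)) by (field; lra).
      rewrite Rabs_pos_eq; [rewrite S_INR in *; field; lra|].
      left; apply Rdiv_lt_0_compat; [pose proof (pos_INR n); lra|assumption].
    + replace (Finite 1) with (Rbar_plus 1 (Rbar_mult (r - 1) 0)) by (simpl; f_equal; ring).
      apply is_lim_seq_plus'; [apply is_lim_seq_const|].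
      apply (is_lim_seq_scal_l _ (r - 1) 0).
      apply (is_lim_seq_incr_1 (fun n => / INR n)).
      apply (is_lim_seq_inv INR p_infty); [apply is_lim_seq_INR|discriminate]. }
destruct (CV_disk_inside (binom_majorant r) x) as [l Hl].
{ rewrite E, Rinv_1, Rabs_pos_eq; simpl; lra. }
exists l; apply is_series_ext with (2 := Hl); intros n; apply Rabs_pos_eq.
apply Rmult_le_pos; [left; apply binom_majorant_pos, Hr|apply pow_le, Hx].
Qed.

(** The case e = 1: (1 + t)^al solves (1 + t) f' = al f. The radius [rho] is the midpoint between
    |t| and 1, so that t lies inside and the coefficients times rho^j stay bounded. *)
Lemma Cexp_binomial (al : C) (t : R) :
  Rabs t < 1 ->
  is_cseries (fun j => cbinom al j * RtoC t ^ j)%C (Cexp (al * RtoC (ln (1 + t)))).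
Proof.
intros Ht.
set (rho := (1 + Rabs t) / 2).
assert (Hrho : 0 <= rho < 1) by (unfold rho; pose proof (Rabs_pos t); lra).
set (r := Cmod al + 1).
assert (Hr : 0 < r) by (unfold r; pose proof (Cmod_ge_0 al); lra).
destruct (binom_majorant_summable r rho Hr Hrho) as [M HM].
apply power_series_cexp with (e := 1) (rho := rho) (M := M) (G := fun t => ln (1 + t)).
- intros j; apply Rle_trans with (binom_majorant r j * rho ^ j).
  + apply Rmult_le_compat_r; [apply pow_le, Hrho|apply cbinom_le; unfold r; lra].
  + set (f := fun j => binom_majorant r j * rho ^ j).
    assert (Hf : forall n, 0 <= f n).
    { intros n; apply Rmult_le_pos; [left; apply binom_majorant_pos, Hr|apply pow_le, Hrho]. }
    apply Rle_trans with (sum_n f j); [|apply sum_n_le_series; [exact Hf|exact HM]].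
    destruct j; [rewrite sum_n_OR; apply Rle_refl|]; rewrite sum_n_SR.
    pose proof (sum_n_incr f O j Hf ltac:(lia)) as H; rewrite sum_n_OR in H.
    specialize (Hf O); fold (f (S j)); lra.
- reflexivity.
- intros j; cbn [cbinom]; rewrite Rmult_1_l.
  assert (Hj : RtoC (INR (S j)) <> RtoC 0)
    by (intros E; apply RtoC_inj in E; revert E; apply not_0_INR; lia).
  field; exact Hj.
- rewrite Rplus_0_r; apply ln_1.
- intros x Hx; apply Rabs_def2 in Hx; split; [lra|].
  auto_derive; [lra|field; lra].
- unfold rho; lra.
Qed.

(** * Power series on a disc *)

Definition power_series_on (c : nat -> C) (f : C -> C) (z0 : C) (r B : R) : Prop :=
  (exists L : R, is_series (fun j => Cmod (c j) * r ^ j) L /\ L <= B) /\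
  forall z, Cmod (z - z0)%C <= r ->
    is_cseries (fun j => c j * (z - z0) ^ j)%C (f z).

(* The norms sum_j |c_j| r^j are submultiplicative, and a series of functions
   with summable norms is again a power series on the same disc: this replaces
   Cauchy's formula throughout. *)
Definition wiener (f : C -> C) (z0 : C) (r B : R) : Prop :=
  exists c : nat -> C, power_series_on c f z0 r B.

Lemma Cmod_self_le (z0 : C) (r : R) : 0 <= r -> Cmod (z0 - z0)%C <= r.
Proof.
intros Hr; replace (z0 - z0)%C with (RtoC 0) by ring; rewrite Cmod_0; exact Hr.
Qed.

Lemma is_cseries_0 : is_cseries (fun _ => RtoC 0) (RtoC 0).
Proof.
apply is_cseries_eps; intros eps Heps; exists O; intros n _.
replace (sum_n (fun _ => RtoC 0) n - RtoC 0)%C with (RtoC 0); [rewrite Cmod_0; exact Heps|].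
induction n as [|n IH]; [rewrite sum_n_OC; ring|].
rewrite sum_n_SC, Cplus_0_r; exact IH.
Qed.

Lemma is_cseries_single (a : nat -> C) :
  (forall j, a (S j) = RtoC 0) -> is_cseries a (a O).
Proof.
intros H; apply (proj1 (is_cseries_S a (a O))).
replace (a O - a O)%C with (RtoC 0) by ring.
apply is_cseries_ext with (2 := is_cseries_0); intros n; symmetry; apply H.
Qed.

Lemma is_series_single (a : nat -> R) :
  (forall j, a (S j) = 0) -> is_series a (a O).
Proof.
intros H; apply is_series_eps; intros eps Heps; exists O; intros n _.
replace (sum_n a n) with (a O); [rewrite Rminus_eq_0, Rabs_R0; exact Heps|].
induction n as [|n IH]; [rewrite sum_n_OR; reflexivity|].
rewrite sum_n_SR, H, Rplus_0_r; exact IH.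
Qed.

Lemma wiener_ext (f g : C -> C) (z0 : C) (r B : R) :
  (forall z, Cmod (z - z0)%C <= r -> f z = g z) -> wiener f z0 r B -> wiener g z0 r B.
Proof.
intros H [c [HL Hc]]; exists c; split; [exact HL|].
intros z Hz; rewrite <- H by exact Hz; auto.
Qed.

Lemma wiener_le (f : C -> C) (z0 : C) (r r' B B' : R) :
  0 <= r' <= r -> B <= B' -> wiener f z0 r B -> wiener f z0 r' B'.
Proof.
intros Hr HB [c [[L [HL HLB]] Hc]]; exists c; split.
- destruct (series_dominated (fun j => Cmod (c j) * r' ^ j) (fun j => Cmod (c j) * r ^ j) L)
    as [L' [HL' Hle]]; [|exact HL|exists L'; split; [exact HL'|lra]].
  intros n; split.
  + apply Rmult_le_pos; [apply Cmod_ge_0|apply pow_le, Hr].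
  + apply Rmult_le_compat_l; [apply Cmod_ge_0|apply pow_incr, Hr].
- intros z Hz; apply Hc; lra.
Qed.

Lemma wiener_bound (f : C -> C) (z0 : C) (r B : R) (z : C) :
  wiener f z0 r B -> Cmod (z - z0)%C <= r -> Cmod (f z) <= B.
Proof.
intros [c [[L [HL HLB]] Hc]] Hz.
destruct (cseries_dominated (fun j => c j * (z - z0) ^ j)%C (fun j => Cmod (c j) * r ^ j) L)
  as [l [Hl Hle]]; [|exact HL|].
- intros n; rewrite Cmod_mult, Cmod_pow.
  apply Rmult_le_compat_l; [apply Cmod_ge_0|].
  apply pow_incr; split; [apply Cmod_ge_0|exact Hz].
- rewrite (is_cseries_unique _ _ _ (Hc z Hz) Hl); lra.
Qed.

Lemma wiener_nonneg (f : C -> C) (z0 : C) (r B : R) :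
  0 <= r -> wiener f z0 r B -> 0 <= B.
Proof.
intros Hr H; apply Rle_trans with (Cmod (f z0)); [apply Cmod_ge_0|].
apply (wiener_bound _ _ _ _ _ H), Cmod_self_le, Hr.
Qed.

Lemma wiener_const (a : C) (z0 : C) (r : R) : wiener (fun _ => a) z0 r (Cmod a).
Proof.
exists (fun j => match j with O => a | S _ => RtoC 0 end); split.
- exists (Cmod a); split; [|lra].
  set (s := fun j => Cmod match j with O => a | S _ => RtoC 0 end * r ^ j).
  replace (Cmod a) with (s O) by (unfold s; simpl; ring).
  apply is_series_single; intros j; unfold s; rewrite Cmod_0; ring.
- intros z _.
  set (s := fun j => (match j with O => a | S _ => RtoC 0 end * (z - z0) ^ j)%C).
  refine (eq_rect (s O) (fun x => is_cseries s x) _ a _); [|unfold s; simpl; ring].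
  apply is_cseries_single; intros j; unfold s; ring.
Qed.

Lemma wiener_plus (f g : C -> C) (z0 : C) (r Bf Bg : R) :
  0 <= r -> wiener f z0 r Bf -> wiener g z0 r Bg ->
  wiener (fun z => f z + g z)%C z0 r (Bf + Bg).
Proof.
intros Hr [c [[L [HL HLB]] Hc]] [d [[M [HM HMB]] Hd]].
exists (fun j => c j + d j)%C; split.
- destruct (series_dominated (fun j => Cmod (c j + d j)%C * r ^ j)
    (fun j => Cmod (c j) * r ^ j + Cmod (d j) * r ^ j) (L + M)) as [L' [HL' Hle]].
  + intros j; pose proof (pow_le r j Hr).
    split; [apply Rmult_le_pos; [apply Cmod_ge_0|assumption]|].
    rewrite <- Rmult_plus_distr_r; apply Rmult_le_compat_r; [assumption|apply Cmod_triangle].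
  + exact (is_series_plus _ _ _ _ HL HM).
  + exists L'; split; [exact HL'|lra].
- intros z Hz; apply is_cseries_ext with (2 := is_cseries_plus _ _ _ _ (Hc z Hz) (Hd z Hz)).
  intros n; ring.
Qed.

Lemma wiener_scal (a : C) (f : C -> C) (z0 : C) (r B : R) :
  wiener f z0 r B -> wiener (fun z => a * f z)%C z0 r (Cmod a * B).
Proof.
intros [c [[L [HL HLB]] Hc]]; exists (fun j => a * c j)%C; split.
- exists (Cmod a * L); split; [|apply Rmult_le_compat_l; [apply Cmod_ge_0|exact HLB]].
  apply is_series_ext with (fun j => Cmod a * (Cmod (c j) * r ^ j)).
  + intros n; rewrite Cmod_mult; eqR; ring.
  + exact (is_series_scal (V := R_NormedModule) (Cmod a) _ _ HL).
- intros z Hz; apply is_cseries_ext with (2 := is_cseries_scal a _ _ (Hc z Hz)).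
  intros n; ring.
Qed.

Lemma wiener_mulX (f : C -> C) (z0 : C) (r B : R) :
  0 <= r -> wiener f z0 r B -> wiener (fun z => (z - z0) * f z)%C z0 r (r * B).
Proof.
intros Hr [c [[L [HL HLB]] Hc]].
exists (fun j => match j with O => RtoC 0 | S i => c i end); split.
- exists (r * L); split; [|apply Rmult_le_compat_l; assumption].
  apply (is_series_decr_1 (V := R_NormedModule)); simpl.
  refine (eq_rect (r * L) (fun x => is_series _ x) _ _ _).
  + apply is_series_ext with (fun j => r * (Cmod (c j) * r ^ j)); [intros n; eqR; ring|].
    exact (is_series_scal (V := R_NormedModule) r _ _ HL).
  + change (r * L = r * L + - (Cmod (RtoC 0) * 1)); rewrite Cmod_0; ring.
- intros z Hz; apply (proj1 (is_cseries_S _ _)).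
  replace ((z - z0) * f z - RtoC 0 * (z - z0) ^ 0)%C with ((z - z0) * f z)%C by ring.
  apply is_cseries_ext with (2 := is_cseries_scal (z - z0)%C _ _ (Hc z Hz)).
  intros n; rewrite Cpow_S; ring.
Qed.

(** A Weierstrass theorem for these norms: at each point of the disc the double series is rearranged
    by powers of z - z0. *)
Lemma wiener_sum (f : nat -> C -> C) (g : C -> C) (z0 : C) (r : R) (B : nat -> R) (S0 : R) :
  0 <= r -> (forall n, wiener (f n) z0 r (B n)) -> is_series B S0 ->
  (forall z, Cmod (z - z0)%C <= r -> is_cseries (fun n => f n z) (g z)) ->
  wiener g z0 r S0.
Proof.
intros Hr Hf HB Hg.
apply functional_choice in Hf; destruct Hf as [c Hc].
assert (HA : forall n, exists L : R, is_series (fun j => Cmod (c n j) * r ^ j) L /\ L <= B n)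
  by (intros n; apply (Hc n)).
apply functional_choice in HA; destruct HA as [A HA].
assert (Hc' : forall n z, Cmod (z - z0)%C <= r ->
  is_cseries (fun j => c n j * (z - z0) ^ j)%C (f n z)) by (intros n; apply (Hc n)).
assert (Hcoef : forall j, exists s, is_cseries (fun n => c n j * RtoC r ^ j)%C s).
{ intros j; destruct (cseries_dominated (fun n => c n j * RtoC r ^ j)%C B S0) as [l [Hl _]];
    [|exact HB|exists l; exact Hl].
  intros n; rewrite Cmod_mult, Cmod_pow, Cmod_R, (Rabs_pos_eq r) by exact Hr.
  destruct (HA n) as [H1 H2]; eapply Rle_trans; [|exact H2].
  set (h := fun j => Cmod (c n j) * r ^ j).
  assert (Hh : forall j, 0 <= h j)
    by (intros i; apply Rmult_le_pos; [apply Cmod_ge_0|apply pow_le, Hr]).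
  apply Rle_trans with (sum_n h j); [|apply sum_n_le_series; assumption].
  destruct j; [rewrite sum_n_OR; apply Rle_refl|]; rewrite sum_n_SR.
  pose proof (sum_n_incr h O j Hh ltac:(lia)) as H; rewrite sum_n_OR in H.
  specialize (Hh O); fold (h (S j)); lra. }
assert (Hw : forall w, Cmod w <= r -> forall t,
  (forall n, is_cseries (fun j => c n j * w ^ j)%C (t n)) ->
  exists s : nat -> C, (forall j, is_cseries (fun n => c n j * w ^ j)%C (s j)) /\
    (exists L : R, is_series (fun j => Cmod (s j)) L /\ L <= S0) /\
    exists T, is_cseries t T /\ is_cseries s T).
{ intros w Hwr t Ht.
  assert (HA' : forall n, exists L : R, is_series (fun j => Cmod (c n j * w ^ j)%C) L /\ L <= B n).
  { intros n; destruct (HA n) as [H1 H2].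
    destruct (series_dominated (fun j => Cmod (c n j * w ^ j)%C)
      (fun j => Cmod (c n j) * r ^ j) (A n)) as [L [HL Hle]]; [|exact H1|exists L; split; [exact HL|lra]].
    intros j; split; [apply Cmod_ge_0|].
    rewrite Cmod_mult, Cmod_pow; apply Rmult_le_compat_l; [apply Cmod_ge_0|].
    apply pow_incr; split; [apply Cmod_ge_0|exact Hwr]. }
  apply functional_choice in HA'; destruct HA' as [A' HA'].
  apply cseries_fubini with (A := A') (B := B); auto; intros n; apply (HA' n). }
(* For r = 0 the bounds say nothing about the coefficients of positive index, so their sums over n
   may diverge. Evaluating at w = 0 leaves only the constant terms. *)
destruct (Req_dec r 0) as [Hr0|Hr0].
{ destruct (Hw (RtoC 0)) with (t := fun n => f n z0) as [s [Hs [HL [T [HT1 HT2]]]]].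
  - rewrite Cmod_0; exact Hr.
  - intros n; apply is_cseries_ext with (2 := Hc' n z0 (Cmod_self_le _ _ Hr)).
    intros j; replace (z0 - z0)%C with (RtoC 0) by ring; reflexivity.
  - rewrite Hr0 in *; exists s; split.
    + destruct HL as [L [HL HLS]]; exists (Cmod (s O)); split.
      * set (h := fun j => Cmod (s j) * 0 ^ j).
        replace (Cmod (s O)) with (h O) by (unfold h; simpl; ring).
        apply is_series_single; intros j; unfold h; simpl; ring.
      * apply Rle_trans with L; [|exact HLS].
        pose proof (sum_n_le_series _ L O (fun j => Cmod_ge_0 (s j)) HL) as H.
        rewrite sum_n_OR in H; exact H.
    + intros z Hz.
      assert (Hz0 : (z - z0)%C = RtoC 0).
      { apply Cmod_eq_0; pose proof (Cmod_ge_0 (z - z0)%C); lra. }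
      replace z with z0 by (replace z with (z - z0 + z0)%C by ring; rewrite Hz0; ring).
      rewrite (is_cseries_unique _ _ _ (Hg z0 (Cmod_self_le _ _ (Rle_refl 0))) HT1).
      replace (z0 - z0)%C with (RtoC 0) by ring.
      apply is_cseries_ext with (2 := HT2); intros [|j]; [simpl; ring|].
      rewrite Cpow_S.
      assert (E : s (S j) = RtoC 0); [|rewrite E; ring].
      apply (is_cseries_unique _ _ _ (Hs (S j))).
      apply is_cseries_ext with (2 := is_cseries_0); intros n; rewrite Cpow_S; ring. }
assert (Hrp : 0 < r) by lra.
assert (Hrj : forall j, (RtoC r ^ j)%C <> RtoC 0).
{ intros j; apply Cpow_nz; intros E; apply RtoC_inj in E; lra. }
assert (Hcr : forall j, exists s, is_cseries (fun n => c n j) s).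
{ intros j; destruct (Hcoef j) as [s Hs]; exists (s / RtoC r ^ j)%C.
  unfold Cdiv; rewrite Cmult_comm.
  apply is_cseries_ext with (2 := is_cseries_scal (/ RtoC r ^ j)%C _ _ Hs).
  intros n; field; apply Hrj. }
apply functional_choice in Hcr; destruct Hcr as [s Hs].
exists s; split.
(* At the boundary point z0 + r the terms are c n j r^j, so the absolute bound from the interchange
   is exactly the norm bound for [s]. *)
- destruct (Hw (RtoC r)) with (t := fun n => f n (z0 + RtoC r)%C) as [s' [Hs' [[L [HL HLS]] _]]].
  + rewrite Cmod_R, Rabs_pos_eq; lra.
  + intros n; assert (Hz : Cmod (z0 + RtoC r - z0)%C <= r).
    { replace (z0 + RtoC r - z0)%C with (RtoC r) by ring; rewrite Cmod_R, Rabs_pos_eq; lra. }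
    apply is_cseries_ext with (2 := Hc' n _ Hz).
    intros j; replace (z0 + RtoC r - z0)%C with (RtoC r) by ring; reflexivity.
  + exists L; split; [|exact HLS].
    apply is_series_ext with (2 := HL); intros j.
    rewrite (is_cseries_unique _ _ (RtoC r ^ j * s j)%C (Hs' j)).
    * rewrite Cmod_mult, Cmod_pow, Cmod_R, (Rabs_pos_eq r) by exact Hr; apply Rmult_comm.
    * apply is_cseries_ext with (2 := is_cseries_scal (RtoC r ^ j)%C _ _ (Hs j)).
      intros n; ring.
- intros z Hz.
  destruct (Hw (z - z0)%C Hz) with (t := fun n => f n z) as [s' [Hs' [_ [T [HT1 HT2]]]]].
  + intros n; apply Hc', Hz.
  + rewrite (is_cseries_unique _ _ _ (Hg z Hz) HT1).
    apply is_cseries_ext with (2 := HT2); intros j.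
    apply (is_cseries_unique _ _ _ (Hs' j)); rewrite Cmult_comm.
    apply is_cseries_ext with (2 := is_cseries_scal ((z - z0) ^ j)%C _ _ (Hs j)).
    intros n; ring.
Qed.

(** The Cauchy product is avoided: expanding only f gives the sum of the functions c_j (z - z0)^j g,
    each of norm at most |c_j| r^j Bg, and [wiener_sum] applies. *)
Lemma wiener_mult (f g : C -> C) (z0 : C) (r Bf Bg : R) :
  0 <= r -> wiener f z0 r Bf -> wiener g z0 r Bg ->
  wiener (fun z => f z * g z)%C z0 r (Bf * Bg).
Proof.
intros Hr [c [[L [HL HLB]] Hc]] Hg.
pose proof (wiener_nonneg _ _ _ _ Hr Hg) as HBg.
apply wiener_le with (r := r) (B := Bg * L); [lra| |].
{ rewrite Rmult_comm; apply Rmult_le_compat_r; assumption. }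
apply wiener_sum with (f := fun j z => (c j * ((z - z0) ^ j * g z))%C)
  (B := fun j => Bg * (Cmod (c j) * r ^ j)); [exact Hr| | |].
- intros j; replace (Bg * (Cmod (c j) * r ^ j)) with (Cmod (c j) * (r ^ j * Bg)) by ring.
  apply wiener_scal; induction j as [|j IH].
  + apply wiener_le with (r := r) (B := Bg); [lra|simpl; lra|].
    apply wiener_ext with (2 := Hg); intros z _; simpl; ring.
  + apply wiener_ext with (fun z => (z - z0) * ((z - z0) ^ j * g z))%C.
    * intros z _; rewrite Cpow_S; ring.
    * simpl; rewrite Rmult_assoc; apply wiener_mulX; assumption.
- exact (is_series_scal (V := R_NormedModule) Bg _ _ HL).
- intros z Hz; rewrite Cmult_comm.
  apply is_cseries_ext with (2 := is_cseries_scal (g z) _ _ (Hc z Hz)); intros n; ring.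
Qed.

Lemma wiener_id (z0 : C) (r : R) : 0 <= r -> wiener (fun z => z) z0 r (Cmod z0 + r).
Proof.
intros Hr; apply wiener_ext with (fun z => z0 + (z - z0) * RtoC 1)%C; [intros z _; ring|].
apply wiener_plus; [exact Hr|apply wiener_const|].
apply wiener_le with (r := r) (B := r * Cmod (RtoC 1)); [lra|rewrite Cmod_1; lra|].
apply wiener_mulX; [exact Hr|apply wiener_const].
Qed.

Lemma Cexp_plus (z w : C) : Cexp (z + w)%C = (Cexp z * Cexp w)%C.
Proof.
unfold Cexp; rewrite re_plus, im_plus, exp_plus, cos_plus, sin_plus.
apply injective_projections; simpl; ring.
Qed.

Lemma Cmod_Cexp (z : C) : Cmod (Cexp z) = exp (Re z).
Proof.
unfold Cexp, Cmod; simpl.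
replace (_ + _) with (exp (Re z) * exp (Re z)).
- apply sqrt_square; left; apply exp_pos.
- pose proof (sin2_cos2 (Im z)) as H; unfold Rsqr in H.
  transitivity (exp (Re z) * exp (Re z) * (sin (Im z) * sin (Im z) + cos (Im z) * cos (Im z)));
    [rewrite H; ring|ring].
Qed.

(** With lam = - ln u and u >= 1 the bound is u^(r - Re z0), the source of all estimates in the
    summation index n. *)
Lemma wiener_exp (lam : R) (z0 : C) (r : R) :
  0 <= r -> wiener (fun z => Cexp (z * RtoC lam)%C) z0 r (exp (Re z0 * lam + Rabs lam * r)).
Proof.
intros Hr.
apply wiener_ext with (fun z => Cexp (z0 * RtoC lam)%C * Cexp ((z - z0) * RtoC lam)%C)%C.
{ intros z _; rewrite <- Cexp_plus; f_equal; ring. }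
rewrite exp_plus, <- re_scal_r, <- Cmod_Cexp; apply wiener_scal.
exists (fun j => RtoC (/ INR (fact j) * lam ^ j)); split.
- exists (exp (Rabs lam * r)); split; [|lra].
  apply is_series_ext with (fun j => / INR (fact j) * (Rabs lam * r) ^ j).
  + intros n; rewrite Cmod_R, Rabs_mult, <- RPow_abs, (Rabs_pos_eq (/ _)), Rpow_mult_distr;
      [eqR; ring|left; apply Rinv_0_lt_compat, INR_fact_lt_0].
  + exact (proj1 (is_pseries_R _ _ _) (is_exp_Reals _)).
- intros z _; apply is_cseries_ext with (2 := Cexp_series _); intros n.
  rewrite RtoC_mult, RtoC_pow, Cpow_mult_l; ring.
Qed.

Lemma power_series_on_center (c : nat -> C) (g : C -> C) (z0 : C) (r B : R) :
  0 <= r -> power_series_on c g z0 r B -> g z0 = c O.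
Proof.
intros Hr [_ Hc].
apply (is_cseries_unique _ _ _ (Hc z0 (Cmod_self_le _ _ Hr))).
  set (s := fun j => (c j * (z0 - z0) ^ j)%C).
  replace (c O) with (s O) by (unfold s; simpl; ring).
  apply is_cseries_single; intros j; unfold s; rewrite Cpow_S; ring.
Qed.

Lemma power_series_on_factor (c : nat -> C) (g : C -> C) (z0 : C) (r B : R) :
  0 < r -> power_series_on c g z0 r B ->
  exists h, power_series_on (fun j => c (S j)) h z0 r (B / r) /\
    forall z, Cmod (z - z0)%C <= r -> g z = (g z0 + (z - z0) * h z)%C.
Proof.
intros Hr Hg.
pose proof (power_series_on_center _ _ _ _ _ (Rlt_le _ _ Hr) Hg) as H0.
destruct Hg as [[L [HL HLB]] Hc].
assert (HL' : is_series (fun j => Cmod (c (S j)) * r ^ j) ((L - Cmod (c O)) / r)).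
{ unfold Rdiv; rewrite Rmult_comm.
  apply is_series_ext with (fun j => / r * (Cmod (c (S j)) * r ^ S j)).
  { intros n; simpl; field; lra. }
  refine (is_series_scal (V := R_NormedModule) (/ r) _ _ _).
  apply (is_series_incr_1 (V := R_NormedModule) (fun j => Cmod (c j) * r ^ j)).
  refine (eq_rect L (fun x => is_series _ x) HL _ _).
  change (@eq R L (L - Cmod (c O) + Cmod (c O) * 1)); ring. }
assert (Hex : forall z, exists l, Cmod (z - z0)%C <= r ->
  is_cseries (fun j => c (S j) * (z - z0) ^ j)%C l).
{ intros z; destruct (Rle_dec (Cmod (z - z0)%C) r) as [Hz|Hz]; [|exists (RtoC 0); lra].
  destruct (cseries_dominated (fun j => c (S j) * (z - z0) ^ j)%C
    (fun j => Cmod (c (S j)) * r ^ j) ((L - Cmod (c O)) / r)) as [l [Hl _]]; [|exact HL'|exists l; auto].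
  intros n; rewrite Cmod_mult, Cmod_pow.
  apply Rmult_le_compat_l; [apply Cmod_ge_0|].
  apply pow_incr; split; [apply Cmod_ge_0|exact Hz]. }
apply functional_choice in Hex; destruct Hex as [h Hh]; exists h; split.
- split; [|exact Hh]; exists ((L - Cmod (c O)) / r); split; [exact HL'|].
  apply Rmult_le_compat_r; [left; apply Rinv_0_lt_compat, Hr|].
  pose proof (Cmod_ge_0 (c O)); lra.
- intros z Hz; rewrite H0.
  apply (is_cseries_unique _ _ _ (Hc z Hz)), (proj1 (is_cseries_S _ _)).
  replace (c O + (z - z0) * h z - c O * (z - z0) ^ 0)%C with ((z - z0) * h z)%C
    by (simpl; ring).
  apply is_cseries_ext with (2 := is_cseries_scal (z - z0)%C _ _ (Hh z Hz)).
  intros n; rewrite Cpow_S; ring.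
Qed.

(** * Analytic functions, poles and the identity theorem *)

Definition analytic_at (f : C -> C) (z0 : C) : Prop :=
  exists r B : R, 0 < r /\ wiener f z0 r B.

Definition punctured (z0 : C) (P : C -> Prop) : Prop :=
  exists r : R, 0 < r /\ forall z, 0 < Cmod (z - z0)%C < r -> P z.

(* Either a simple pole with residue rho, or rho = 0 and f is regular at z0 up
   to the value f z0. *)
Definition at_most_simple_pole (f : C -> C) (z0 rho : C) : Prop :=
  exists g, analytic_at g z0 /\ g z0 = rho /\
    punctured z0 (fun z => f z = g z / (z - z0))%C.

(** The quotient form of [laurent_at]: it is stable under subtraction through a common denominator,
    and [laurent_of_analytic] and [meromorphic_of_laurent] translate between the two. *)
Definition meromorphic_at (f : C -> C) (z0 : C) : Prop :=
  exists (N : nat) (g : C -> C), analytic_at g z0 /\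
    punctured z0 (fun z => f z = g z / (z - z0) ^ N)%C.

Lemma punctured_and (z0 : C) (P Q : C -> Prop) :
  punctured z0 P -> punctured z0 Q -> punctured z0 (fun z => P z /\ Q z).
Proof.
intros [r [Hr HP]] [s [Hs HQ]]; exists (Rmin r s); split.
- apply Rmin_glb_lt; assumption.
- intros z Hz; pose proof (Rmin_l r s); pose proof (Rmin_r r s).
  split; [apply HP|apply HQ]; lra.
Qed.

Lemma punctured_imp (z0 : C) (P Q : C -> Prop) :
  (forall z, z <> z0 -> P z -> Q z) -> punctured z0 P -> punctured z0 Q.
Proof.
intros H [r [Hr HP]]; exists r; split; [exact Hr|]; intros z Hz; apply H, HP, Hz.
intros ->; replace (z0 - z0)%C with (RtoC 0) in Hz by ring; rewrite Cmod_0 in Hz; lra.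
Qed.

Lemma punctured_all (z0 : C) (P : C -> Prop) : (forall z, P z) -> punctured z0 P.
Proof. intros H; exists 1; split; [lra|auto]. Qed.

Lemma Cminus_neq_0 (z z0 : C) : z <> z0 -> (z - z0)%C <> RtoC 0.
Proof.
intros H E; apply H; replace z with (z - z0 + z0)%C by ring; rewrite E; ring.
Qed.

Lemma analytic_common (f g : C -> C) (z0 : C) :
  analytic_at f z0 -> analytic_at g z0 ->
  exists r Bf Bg : R, 0 < r /\ wiener f z0 r Bf /\ wiener g z0 r Bg.
Proof.
intros [r [Bf [Hr Hf]]] [s [Bg [Hs Hg]]]; exists (Rmin r s), Bf, Bg.
assert (0 < Rmin r s) by (apply Rmin_glb_lt; assumption).
split; [assumption|split].
- apply wiener_le with (3 := Hf); [pose proof (Rmin_l r s)|]; lra.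
- apply wiener_le with (3 := Hg); [pose proof (Rmin_r r s)|]; lra.
Qed.

Lemma analytic_const (a z0 : C) : analytic_at (fun _ => a) z0.
Proof. exists 1, (Cmod a); split; [lra|apply wiener_const]. Qed.

Lemma analytic_id (z0 : C) : analytic_at (fun z => z) z0.
Proof. exists 1, (Cmod z0 + 1); split; [lra|apply wiener_id; lra]. Qed.

Lemma analytic_exp (lam : R) (z0 : C) : analytic_at (fun z => Cexp (z * RtoC lam)%C) z0.
Proof. eexists 1, _; split; [lra|apply wiener_exp; lra]. Qed.

Lemma analytic_plus (f g : C -> C) (z0 : C) :
  analytic_at f z0 -> analytic_at g z0 -> analytic_at (fun z => f z + g z)%C z0.
Proof.
intros Hf Hg; destruct (analytic_common f g z0 Hf Hg) as [r [Bf [Bg [Hr [H1 H2]]]]].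
exists r, (Bf + Bg); split; [exact Hr|apply wiener_plus; [lra|assumption|assumption]].
Qed.

Lemma analytic_mult (f g : C -> C) (z0 : C) :
  analytic_at f z0 -> analytic_at g z0 -> analytic_at (fun z => f z * g z)%C z0.
Proof.
intros Hf Hg; destruct (analytic_common f g z0 Hf Hg) as [r [Bf [Bg [Hr [H1 H2]]]]].
exists r, (Bf * Bg); split; [exact Hr|apply wiener_mult; [lra|assumption|assumption]].
Qed.

Lemma analytic_ext (f g : C -> C) (z0 : C) :
  (forall z, f z = g z) -> analytic_at f z0 -> analytic_at g z0.
Proof.
intros H [r [B [Hr Hf]]]; exists r, B; split; [exact Hr|].
apply wiener_ext with (2 := Hf); auto.
Qed.

Lemma analytic_sub_const (a z0 : C) : analytic_at (fun z => z - a)%C z0.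
Proof. apply (analytic_plus (fun z => z) (fun _ => - a)%C); [apply analytic_id|apply analytic_const]. Qed.

Lemma analytic_pow (f : C -> C) (z0 : C) (n : nat) :
  analytic_at f z0 -> analytic_at (fun z => f z ^ n)%C z0.
Proof.
intros Hf; induction n as [|n IH]; [exact (analytic_const (RtoC 1) z0)|].
apply analytic_ext with (fun z => f z * f z ^ n)%C; [reflexivity|].
apply analytic_mult; assumption.
Qed.

Lemma analytic_shift (f : C -> C) (a z0 : C) :
  analytic_at f (z0 + a)%C -> analytic_at (fun z => f (z + a)%C) z0.
Proof.
intros [r [B [Hr [c [HL Hc]]]]]; exists r, B; split; [exact Hr|].
exists c; split; [exact HL|]; intros z Hz.
replace (z - z0)%C with (z + a - (z0 + a))%C in * by ring; auto.
Qed.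

Lemma punctured_shift (P : C -> Prop) (a z0 : C) :
  punctured (z0 + a)%C P -> punctured z0 (fun z => P (z + a)%C).
Proof.
intros [r [Hr HP]]; exists r; split; [exact Hr|]; intros z Hz; apply HP.
replace (z + a - (z0 + a))%C with (z - z0)%C by ring; exact Hz.
Qed.

Lemma cseries_geom (q : C) :
  Cmod q < 1 -> is_cseries (fun j => q ^ j)%C (/ (1 - q))%C.
Proof.
intros Hq; pose proof (Cmod_ge_0 q).
destruct (cseries_dominated (fun j => q ^ j)%C (fun j => Cmod q ^ j) (/ (1 - Cmod q)))
  as [l [Hl _]].
- intros n; rewrite Cmod_pow; lra.
- apply is_series_geom; rewrite Rabs_pos_eq; assumption.
- assert (Hne : (RtoC 1 - q)%C <> RtoC 0).
  { intros E; assert (Hq1 : q = RtoC 1).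
    { replace q with (RtoC 1 - (RtoC 1 - q))%C by ring; rewrite E; ring. }
    rewrite Hq1, Cmod_1 in Hq; lra. }
  replace (/ (1 - q))%C with l; [exact Hl|].
  pose proof (proj2 (is_cseries_S _ _) Hl) as H1; cbn beta in H1.
  assert (E : (l - q ^ 0)%C = (q * l)%C).
  { apply (is_cseries_unique _ _ _ H1).
    apply is_cseries_ext with (2 := is_cseries_scal q _ _ Hl); reflexivity. }
  simpl in E.
  assert (E2 : (l * (1 - q))%C = RtoC 1).
  { transitivity (l - 1 - q * l + 1)%C; [ring|rewrite E; ring]. }
  transitivity (l * (1 - q) * / (1 - q))%C; [field; exact Hne|rewrite E2; ring].
Qed.

(** A geometric series in (z - z0) / (a - z0); within half the distance to a its terms are at most
    2^(-j). *)
Lemma analytic_inv (a z0 : C) : z0 <> a -> analytic_at (fun z => / (z - a))%C z0.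
Proof.
intros Ha; apply Cminus_neq_0 in Ha.
pose proof (proj1 (Cmod_gt_0 _) Ha) as Hd; set (d := Cmod (z0 - a)%C) in *.
assert (Hna : (- (z0 - a))%C <> RtoC 0).
{ intros E; apply Ha; replace (z0 - a)%C with (- - (z0 - a))%C by ring; rewrite E; ring. }
exists (d / 2), (/ d * / (1 - / 2)); split; [lra|].
exists (fun j => / (z0 - a) * (/ (- (z0 - a))) ^ j)%C; split.
- exists (/ d * / (1 - / 2)); split; [|lra].
  apply is_series_ext with (fun j => / d * (/ 2) ^ j).
  + intros n; rewrite Cmod_mult, Cmod_pow, !Cmod_inv, Cmod_opp by assumption; fold d.
    eqR; rewrite Rmult_assoc, <- Rpow_mult_distr; do 2 f_equal; field; lra.
  + apply (is_series_scal (V := R_NormedModule) (/ d)), is_series_geom.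
    rewrite Rabs_pos_eq; lra.
- intros z Hz.
  assert (Hq : Cmod (/ (- (z0 - a)) * (z - z0))%C < 1).
  { rewrite Cmod_mult, Cmod_inv, Cmod_opp by assumption; fold d.
    apply Rle_lt_trans with (/ d * (d / 2)); [|replace (/ d * (d / 2)) with (/ 2) by (field; lra); lra].
    apply Rmult_le_compat_l; [left; apply Rinv_0_lt_compat, Hd|exact Hz]. }
  assert (Hza : (z - a)%C <> RtoC 0).
  { intros E; assert (E' : (z - z0)%C = (- (z0 - a))%C).
    { transitivity (z - a - (z0 - a))%C; [ring|rewrite E; ring]. }
    rewrite E' in Hz; rewrite Cmod_opp in Hz; fold d in Hz; lra. }
  replace (/ (z - a))%C with (/ (z0 - a) * / (1 - / (- (z0 - a)) * (z - z0)))%C.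
  + apply is_cseries_ext with (2 := is_cseries_scal _ _ _ (cseries_geom _ Hq)).
    intros n; rewrite Cpow_mult_l; ring.
  + field; repeat split; try assumption.
    intros E; apply Hza.
    transitivity (- ((- (z0 - a)) - (z - z0)))%C; [ring|].
    rewrite E; ring.
Qed.

Lemma simple_pole_near (f g : C -> C) (z0 rho : C) :
  punctured z0 (fun z => f z = g z) ->
  at_most_simple_pole f z0 rho -> at_most_simple_pole g z0 rho.
Proof.
intros Hfg [h [Hh [H0 Hf]]]; exists h; split; [exact Hh|split; [exact H0|]].
apply punctured_imp with (2 := punctured_and _ _ _ Hfg Hf).
intros z _ [H1 H2]; rewrite <- H1; exact H2.
Qed.

Lemma simple_pole_div (g : C -> C) (z0 : C) :
  analytic_at g z0 -> at_most_simple_pole (fun z => g z / (z - z0))%C z0 (g z0).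
Proof.
intros Hg; exists g; split; [exact Hg|split; [reflexivity|]].
apply punctured_all; reflexivity.
Qed.

Lemma simple_pole_analytic (f : C -> C) (z0 : C) :
  analytic_at f z0 -> at_most_simple_pole f z0 (RtoC 0).
Proof.
intros Hf; exists (fun z => (z - z0) * f z)%C; split; [|split].
- apply analytic_mult; [apply analytic_sub_const|exact Hf].
- ring.
- apply punctured_imp with (2 := punctured_all z0 _ (fun _ => I)).
  intros z Hz _; field; apply Cminus_neq_0, Hz.
Qed.

Lemma simple_pole_plus (f g : C -> C) (z0 rf rg : C) :
  at_most_simple_pole f z0 rf -> at_most_simple_pole g z0 rg ->
  at_most_simple_pole (fun z => f z + g z)%C z0 (rf + rg)%C.
Proof.
intros [F [HF [HF0 Hf]]] [G [HG [HG0 Hg]]]; exists (fun z => F z + G z)%C.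
split; [apply analytic_plus; assumption|split; [rewrite HF0, HG0; reflexivity|]].
apply punctured_imp with (2 := punctured_and _ _ _ Hf Hg).
intros z Hz [-> ->]; field; apply Cminus_neq_0, Hz.
Qed.

(** A zero of h at z0 turns the residue into 0; this is how the poles of shifted copies of F are
    cancelled. *)
Lemma simple_pole_mult (h f : C -> C) (z0 rho : C) :
  analytic_at h z0 -> at_most_simple_pole f z0 rho ->
  at_most_simple_pole (fun z => h z * f z)%C z0 (h z0 * rho)%C.
Proof.
intros Hh [F [HF [HF0 Hf]]]; exists (fun z => h z * F z)%C.
split; [apply analytic_mult; assumption|split; [rewrite HF0; reflexivity|]].
apply punctured_imp with (2 := Hf).
intros z Hz ->; field; apply Cminus_neq_0, Hz.
Qed.

Lemma simple_pole_shift (f : C -> C) (a z0 rho : C) :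
  at_most_simple_pole f (z0 + a)%C rho ->
  at_most_simple_pole (fun z => f (z + a)%C) z0 rho.
Proof.
intros [F [HF [HF0 Hf]]]; exists (fun z => F (z + a)%C).
split; [apply analytic_shift, HF|split; [exact HF0|]].
apply punctured_shift in Hf; apply punctured_imp with (2 := Hf).
intros z _ ->; f_equal; ring.
Qed.

Lemma simple_pole_sum_n (f : nat -> C -> C) (z0 : C) (rho : nat -> C) (n : nat) :
  (forall j, (j <= n)%nat -> at_most_simple_pole (f j) z0 (rho j)) ->
  at_most_simple_pole (fun z => sum_n (fun j => f j z) n) z0 (sum_n rho n).
Proof.
intros H; induction n as [|n IH].
- rewrite sum_n_OC; apply simple_pole_near with (2 := H O (Nat.le_refl 0)).
  apply punctured_all; intros z; rewrite sum_n_OC; reflexivity.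
- rewrite sum_n_SC.
  apply simple_pole_near with (2 := simple_pole_plus _ _ _ _ _
    (IH (fun j Hj => H j (Nat.le_trans _ _ _ Hj (Nat.le_succ_diag_r n))))
    (H (S n) (Nat.le_refl _))).
  apply punctured_all; intros z; rewrite sum_n_SC; reflexivity.
Qed.

Lemma meromorphic_simple_pole (f : C -> C) (z0 rho : C) :
  at_most_simple_pole f z0 rho -> meromorphic_at f z0.
Proof.
intros [g [Hg [_ Hf]]]; exists 1%nat, g; split; [exact Hg|].
apply punctured_imp with (2 := Hf); intros z _ ->; rewrite Cpow_1_r; reflexivity.
Qed.

Lemma meromorphic_minus (f g : C -> C) (z0 : C) :
  meromorphic_at f z0 -> meromorphic_at g z0 -> meromorphic_at (fun z => f z - g z)%C z0.
Proof.
intros [N [F [HF Hf]]] [M [G [HG Hg]]].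
exists (N + M)%nat, (fun z => F z * (z - z0) ^ M + - 1 * (G z * (z - z0) ^ N))%C; split.
- assert (Hp : forall n, analytic_at (fun z => (z - z0) ^ n)%C z0)
    by (intros n; apply analytic_pow, analytic_sub_const).
  apply analytic_plus; [|apply analytic_mult; [apply analytic_const|]];
    apply analytic_mult; auto.
- apply punctured_imp with (2 := punctured_and _ _ _ Hf Hg); intros z Hz [-> ->].
  rewrite Cpow_add_r.
  pose proof (Cpow_nz _ N (Cminus_neq_0 _ _ Hz)).
  pose proof (Cpow_nz _ M (Cminus_neq_0 _ _ Hz)).
  field; split; assumption.
Qed.

(** * Passage between quotients and Laurent series *)

Lemma laurent_of_analytic (f g : C -> C) (z0 : C) (N : nat) :
  analytic_at g z0 -> punctured z0 (fun z => f z = g z / (z - z0) ^ N)%C ->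
  exists c, laurent_at f z0 N c /\ c O = g z0.
Proof.
intros [r [B [Hr [c Hg]]]] [s [Hs Hf]]; exists c; split.
- exists (Rmin r s); split; [apply Rmin_glb_lt; assumption|]; intros z Hz.
  pose proof (Rmin_l r s); pose proof (Rmin_r r s).
  rewrite Hf by lra; unfold Cdiv; rewrite Cmult_comm.
  assert (H1 : is_cseries (fun j => c j * (z - z0) ^ j)%C (g z)) by (apply Hg; lra).
  refine (is_cseries_ext _ _ _ _ (is_cseries_scal (/ (z - z0) ^ N)%C _ _ H1)).
  intros n; ring.
- symmetry; apply (power_series_on_center _ _ _ _ _ (Rlt_le _ _ Hr) Hg).
Qed.

Lemma cseries_terms_bounded (a : nat -> C) (l : C) :
  is_cseries a l -> exists M, forall n, Cmod (a n) <= M.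
Proof.
intros H.
destruct (filterlim_bounded (V := C_NormedModule) (sum_n a)) as [M HM].
{ exists l; exact H. }
assert (HM' : forall n, Cmod (sum_n a n) <= M) by exact HM.
exists (M + M); intros [|n].
- specialize (HM' O); rewrite sum_n_OC in HM'; pose proof (Cmod_ge_0 (a O)); lra.
- replace (a (S n)) with (sum_n a (S n) + - sum_n a n)%C by (rewrite sum_n_SC; ring).
  eapply Rle_trans; [apply Cmod_triangle|]; rewrite Cmod_opp.
  apply Rplus_le_compat; apply HM'.
Qed.

(** Convergence at distance r / 2 bounds the terms c_j (r / 2)^j, so on the disc of radius r / 4
    they are dominated by a geometric series. The numerator is f (z) (z - z0)^N, completed by c_0 at
    z0. *)
Lemma meromorphic_of_laurent (f : C -> C) (z0 : C) (N : nat) (c : nat -> C) :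
  laurent_at f z0 N c -> meromorphic_at f z0.
Proof.
intros [r [Hr Hf]].
set (g := fun z => if Ceq_dec z z0 then c O else (f z * (z - z0) ^ N)%C).
exists N, g; split.
- assert (Hz1 : Cmod (z0 + RtoC (r / 2) - z0)%C = r / 2).
  { replace (z0 + RtoC (r / 2) - z0)%C with (RtoC (r / 2)) by ring.
    rewrite Cmod_R, Rabs_pos_eq; lra. }
  assert (H1 : is_cseries (fun j => c j * (z0 + RtoC (r / 2) - z0) ^ j
      / (z0 + RtoC (r / 2) - z0) ^ N)%C (f (z0 + RtoC (r / 2))%C)).
  { apply Hf; rewrite Hz1; lra. }
  destruct (cseries_terms_bounded _ _ H1) as [M HM].
  assert (Hnz : (z0 + RtoC (r / 2) - z0)%C <> RtoC 0)
    by (apply Cmod_gt_0; rewrite Hz1; lra).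
  assert (Hc : forall j, Cmod (c j) * (r / 2) ^ j <= M * (r / 2) ^ N).
  { intros j; specialize (HM j).
    rewrite Cmod_div, Cmod_mult, !Cmod_pow, Hz1 in HM by (apply Cpow_nz, Hnz).
    assert (0 < (r / 2) ^ N) by (apply pow_lt; lra).
    apply Rmult_le_reg_r with (/ (r / 2) ^ N); [apply Rinv_0_lt_compat; assumption|].
    rewrite (Rmult_assoc M), Rinv_r, Rmult_1_r by lra; exact HM. }
  set (K := M * (r / 2) ^ N) in *.
  assert (HK : is_series (fun j => K * (/ 2) ^ j) (K * / (1 - / 2))).
  { apply (is_series_scal (V := R_NormedModule) K), is_series_geom.
    rewrite Rabs_pos_eq; lra. }
  exists (r / 4), (K * / (1 - / 2)); split; [lra|]; exists c; split.
  + apply series_dominated with (2 := HK); intros j; split.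
    * apply Rmult_le_pos; [apply Cmod_ge_0|apply pow_le; lra].
    * replace (r / 4) with (r / 2 * / 2) by field.
      rewrite Rpow_mult_distr, <- Rmult_assoc.
      apply Rmult_le_compat_r; [apply pow_le; lra|apply Hc].
  + intros z Hz; unfold g; destruct (Ceq_dec z z0) as [->|Hne].
    * set (s := fun j => (c j * (z0 - z0) ^ j)%C).
      replace (c O) with (s O) by (unfold s; simpl; ring).
      apply is_cseries_single; intros j; unfold s; rewrite Cpow_S; ring.
    * apply Cminus_neq_0 in Hne; rewrite Cmult_comm.
      assert (H2 : is_cseries (fun j => c j * (z - z0) ^ j / (z - z0) ^ N)%C (f z)).
      { apply Hf; split; [apply Cmod_gt_0, Hne|lra]. }
      apply is_cseries_ext with (2 := is_cseries_scal ((z - z0) ^ N)%C _ _ H2).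
      intros n; field; apply Cpow_nz, Hne.
- apply punctured_imp with (2 := punctured_all z0 _ (fun _ => I)); intros z Hz _.
  unfold g; destruct (Ceq_dec z z0) as [E|_]; [contradiction|].
  field; apply Cpow_nz, Cminus_neq_0, Hz.
Qed.

(** Leading zero coefficients are divided out by induction. Once c_0 is nonzero, g = c_0 + (z - z0)
    h with |h| <= B / r, and the radius |c_0| / (B / r + 1) keeps the second summand smaller than
    |c_0|. *)
Lemma power_series_zeros_isolated (m : nat) : forall (c : nat -> C) (g : C -> C) (z0 : C) (r B : R),
  0 < r -> power_series_on c g z0 r B -> c m <> RtoC 0 ->
  punctured z0 (fun z => g z <> RtoC 0).
Proof.
induction m as [|m IH]; intros c g z0 r B Hr Hg Hm;
  destruct (power_series_on_factor _ _ _ _ _ Hr Hg) as [h [Hh Hgh]];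
  pose proof (power_series_on_center _ _ _ _ _ (Rlt_le _ _ Hr) Hg) as H0.
2: destruct (Ceq_dec (c O) (RtoC 0)) as [Hc0|Hc0].
2: { apply punctured_imp with (fun z => h z <> RtoC 0 /\ Cmod (z - z0)%C <= r).
     - intros z Hz [H1 H2]; rewrite (Hgh z H2), H0, Hc0, Cplus_0_l.
       apply Cmult_neq_0; [apply Cminus_neq_0, Hz|exact H1].
     - apply punctured_and; [apply (IH _ _ _ _ _ Hr Hh Hm)|].
       exists r; split; [exact Hr|intros z Hz; lra]. }
1: rename Hm into Hc0.
all: assert (Hhw : wiener h z0 r (B / r)) by (eexists; exact Hh);
  pose proof (wiener_nonneg _ _ _ _ (Rlt_le _ _ Hr) Hhw) as HB;
  apply Cmod_gt_0 in Hc0;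
  exists (Rmin r (Cmod (c O) / (B / r + 1)));
  (split; [apply Rmin_glb_lt; [exact Hr|apply Rdiv_lt_0_compat; lra]|]);
  intros z Hz E;
  pose proof (Rmin_l r (Cmod (c O) / (B / r + 1)));
  pose proof (Rmin_r r (Cmod (c O) / (B / r + 1)));
  rewrite (Hgh z), H0 in E by lra;
  assert (E2 : Cmod (c O) = Cmod (z - z0)%C * Cmod (h z))
    by (rewrite <- Cmod_mult, <- Cmod_opp; f_equal;
        transitivity ((z - z0) * h z - (c O + (z - z0) * h z))%C; [ring|rewrite E; ring]);
  assert (Hb : Cmod (h z) <= B / r) by (apply (wiener_bound _ _ _ _ _ Hhw); lra);
  assert (H3 : Cmod (z - z0)%C * (B / r + 1) < Cmod (c O))
    by (apply Rmult_lt_reg_r with (/ (B / r + 1));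
        [apply Rinv_0_lt_compat; lra|rewrite (Rmult_assoc _ (B / r + 1)), Rinv_r by lra; unfold Rdiv in *; lra]);
  assert (Cmod (z - z0)%C * Cmod (h z) <= Cmod (z - z0)%C * (B / r))
    by (apply Rmult_le_compat_l; lra);
  lra.
Qed.

Lemma meromorphic_dichotomy (f : C -> C) (z0 : C) :
  meromorphic_at f z0 ->
  punctured z0 (fun z => f z = RtoC 0) \/ punctured z0 (fun z => f z <> RtoC 0).
Proof.
intros [N [g [[r [B [Hr [c Hg]]]] Hf]]].
destruct (classic (exists m, c m <> RtoC 0)) as [[m Hm]|Hc].
- right; apply punctured_imp with (2 := punctured_and _ _ _ Hf
    (power_series_zeros_isolated m c g z0 r B Hr Hg Hm)).
  intros z Hz [-> H]; apply Cmult_neq_0; [exact H|].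
  intros E; apply C1_nz; rewrite <- (Cinv_r ((z - z0) ^ N));
    [rewrite E; ring|apply Cpow_nz, Cminus_neq_0, Hz].
- left; assert (Hg0 : punctured z0 (fun z => g z = RtoC 0)).
  { exists r; split; [exact Hr|]; intros z Hz.
    apply (is_cseries_unique _ _ _ (proj2 Hg z ltac:(lra))).
    apply is_cseries_ext with (2 := is_cseries_0); intros n.
    replace (c n) with (RtoC 0); [ring|].
    destruct (Ceq_dec (c n) (RtoC 0)) as [E|E]; [symmetry; exact E|].
    exfalso; apply Hc; exists n; exact E. }
  apply punctured_imp with (2 := punctured_and _ _ _ Hf Hg0).
  intros z Hz [-> ->]; field; apply Cpow_nz, Cminus_neq_0, Hz.
Qed.

Lemma punctured_inside (z0 z1 : C) (P : C -> Prop) (r : R) :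
  (forall z, 0 < Cmod (z - z0)%C < r -> P z) -> 0 < Cmod (z1 - z0)%C < r ->
  punctured z1 P.
Proof.
intros HP Hz1; set (d := Cmod (z1 - z0)%C) in *.
exists (Rmin d (r - d)); split; [apply Rmin_glb_lt; lra|]; intros z Hz; apply HP.
pose proof (Rmin_l d (r - d)); pose proof (Rmin_r d (r - d)).
pose proof (Cmod_triangle (z - z1)%C (z1 - z0)%C) as H1; fold d in H1.
replace (z - z1 + (z1 - z0))%C with (z - z0)%C in H1 by ring.
pose proof (Cmod_triangle (- (z - z1))%C (z - z0)%C) as H2; rewrite Cmod_opp in H2.
replace (- (z - z1) + (z - z0))%C with (z1 - z0)%C in H2 by ring; fold d in H2; lra.
Qed.

Lemma Cmod_horizontal (x x' y : R) : Cmod ((x, y) - (x', y))%C = Rabs (x - x').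
Proof.
replace ((x, y) - (x', y))%C with (RtoC (x - x')); [apply Cmod_R|].
apply injective_projections; simpl; ring.
Qed.

(** Let s be the supremum of the points of the ray near which h is not identically 0. Near s, off s
    itself, h is either identically 0 or nowhere 0: the first leaves no such points just below s,
    the second contradicts the vanishing of h near points just above s. *)
Lemma meromorphic_identity (h : C -> C) (x0 y K : R) :
  (forall x, x0 <= x -> meromorphic_at h (x, y)) ->
  (forall x, K < x -> punctured (x, y) (fun z => h z = RtoC 0)) ->
  punctured (x0, y) (fun z => h z = RtoC 0).
Proof.
intros Hh HK.
set (bad := fun x => x0 <= x /\ ~ punctured (x, y) (fun z => h z = RtoC 0)).
destruct (classic (bad x0)) as [Hb|Hb];
  [|apply NNPP; intros H; apply Hb; split; [lra|exact H]].
exfalso; destruct (completeness bad) as [s [Hs1 Hs2]].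
- exists K; intros x [_ Hx]; apply Rnot_lt_le; intros H; apply Hx, HK, H.
- exists x0; exact Hb.
- assert (Hx0s : x0 <= s) by (apply Hs1, Hb).
  destruct (meromorphic_dichotomy h (s, y) (Hh s Hx0s)) as [Hp|Hp].
  + pose proof Hp as [r [Hr Hz]].
    assert (s <= s - r / 2); [|lra].
    apply Hs2; intros x Hx; pose proof (Hs1 x Hx) as Hxs; destruct Hx as [_ Hx].
    apply Rnot_lt_le; intros Hlt; apply Hx.
    destruct (Req_dec x s) as [->|Hne]; [exact Hp|].
    apply punctured_inside with (1 := Hz); rewrite Cmod_horizontal.
    rewrite Rabs_left; lra.
  + destruct Hp as [r [Hr Hz]].
    assert (Hg : punctured (s + r / 2, y) (fun z => h z = RtoC 0)).
    { apply NNPP; intros H; assert (s + r / 2 <= s); [|lra].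
      apply Hs1; split; [lra|exact H]. }
    assert (Hn : punctured (s + r / 2, y) (fun z => h z <> RtoC 0)).
    { apply punctured_inside with (1 := Hz); rewrite Cmod_horizontal.
      rewrite Rabs_pos_eq; lra. }
    destruct (punctured_and _ _ _ Hg Hn) as [q [Hq Hc]].
    destruct (Hc (s + r / 2 + q / 2, y)) as [H1 H2]; [|contradiction].
    rewrite Cmod_horizontal, Rabs_pos_eq; lra.
Qed.

(** * The series F and its continuation *)

(* With n = m + 1: y = n + k/2, u = n (n + k) and g (n - 1/2) for
   g (x) = x (x + k). *)
Definition centre (k m : nat) : R := INR (S m) + INR k / 2.
Definition node (k m : nat) : R := INR (S m) * (INR (S m) + INR k).
Definition half_node (k m : nat) : R := (INR m + / 2) * (INR m + / 2 + INR k).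

(* 2 y u^(-w) = g' (n) g (n)^(-w) *)
Definition base_term (k : nat) (w : C) (m : nat) : C :=
  (RtoC (2 * centre k m) * Cexp (- w * RtoC (ln (node k m))))%C.

(* binom (1 - w, j + 1) / (1 - w), a polynomial in w. *)
Fixpoint reduced_binom (w : C) (j : nat) : C :=
  match j with
  | O => RtoC 1
  | S i => (reduced_binom w i * (- (w + RtoC (INR i)) / RtoC (INR (S (S i)))))%C
  end.

Definition ratio_diff (k m j : nat) : R :=
  ((/ 4 + centre k m) / node k m) ^ S j - ((/ 4 - centre k m) / node k m) ^ S j.

(* u^(1 - w) times the difference of the (j + 1)-st powers of
   g (n + 1/2) / u - 1 and g (n - 1/2) / u - 1. *)
Definition shift_term (k : nat) (w : C) (m j : nat) : C :=
  (Cexp ((1 - w) * RtoC (ln (node k m))) * RtoC (ratio_diff k m j))%C.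

Lemma RtoC_INR_S_neq_0 (j : nat) : RtoC (INR (S j)) <> RtoC 0.
Proof. intros E; apply RtoC_inj in E; revert E; apply not_0_INR; lia. Qed.

Lemma INR_S_ge_1 (m : nat) : 1 <= INR (S m).
Proof. rewrite S_INR; pose proof (pos_INR m); lra. Qed.

Lemma INR_k_ge_1 (k : nat) : (1 <= k)%nat -> 1 <= INR k.
Proof. intros H; apply (le_INR 1); exact H. Qed.

Lemma node_ge_sqr (k m : nat) : INR (S m) ^ 2 <= node k m.
Proof.
unfold node; pose proof (INR_S_ge_1 m); pose proof (pos_INR k).
nra.
Qed.

Lemma node_ge_1 (k m : nat) : 1 <= node k m.
Proof.
pose proof (node_ge_sqr k m); pose proof (pow_R1_Rle _ 2 (INR_S_ge_1 m)); lra.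
Qed.

Lemma node_le (k m : nat) : node k m <= (1 + INR k) * INR (S m) ^ 2.
Proof.
unfold node; pose proof (INR_S_ge_1 m); pose proof (pos_INR k).
assert (0 <= INR k * (INR (S m) * (INR (S m) - 1))); [|nra].
apply Rmult_le_pos; [lra|apply Rmult_le_pos; lra].
Qed.

Lemma ln_node_nonneg (k m : nat) : 0 <= ln (node k m).
Proof.
pose proof (node_ge_1 k m) as H.
destruct H as [H|H]; [|rewrite <- H, ln_1; lra].
left; rewrite <- ln_1; apply ln_increasing; lra.
Qed.

Lemma half_node_eq (k m : nat) : half_node k m = node k m * (1 + (/ 4 - centre k m) / node k m).
Proof.
pose proof (node_ge_1 k m).
transitivity (node k m + / 4 - centre k m); [|field; lra].
unfold half_node, node, centre; rewrite S_INR; field.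
Qed.

Lemma half_node_S (k m : nat) : half_node k (S m) = node k m * (1 + (/ 4 + centre k m) / node k m).
Proof.
pose proof (node_ge_1 k m).
transitivity (node k m + / 4 + centre k m); [|field; lra].
unfold half_node, node, centre; field.
Qed.

Definition ratio (k m : nat) : R := (/ 4 + centre k m) / node k m.

Lemma ratio_pos (k m : nat) : 0 < ratio k m.
Proof.
unfold ratio, centre; pose proof (node_ge_1 k m); pose proof (INR_S_ge_1 m).
pose proof (pos_INR k); apply Rdiv_lt_0_compat; lra.
Qed.

(** The bound is attained for k = 1 and m = 0. Being below 1 uniformly in m, it gives convergence of
    the binomial series at every node and one geometric majorant for all tails. *)
Lemma ratio_le_78 (k m : nat) : (1 <= k)%nat -> ratio k m <= 7 / 8.
Proof.
intros Hk; apply INR_k_ge_1 in Hk; pose proof (node_ge_1 k m).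
apply Rmult_le_reg_r with (node k m); [lra|].
replace (ratio k m * node k m) with (/ 4 + centre k m) by (unfold ratio; field; lra).
unfold centre, node; destruct m as [|m]; [simpl; lra|].
rewrite !S_INR; pose proof (pos_INR m); nra.
Qed.

Lemma ratio_le (k m : nat) : ratio k m <= (INR k + 2) / INR (S m).
Proof.
pose proof (node_ge_1 k m); pose proof (INR_S_ge_1 m); pose proof (pos_INR k).
apply Rmult_le_reg_r with (node k m); [lra|].
replace (ratio k m * node k m) with (/ 4 + centre k m) by (unfold ratio; field; lra).
unfold centre, node.
replace ((INR k + 2) / INR (S m) * (INR (S m) * (INR (S m) + INR k)))
  with ((INR k + 2) * (INR (S m) + INR k)) by (field; lra).
assert (0 <= INR k * (INR (S m) + INR k)) by (apply Rmult_le_pos; lra); lra.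
Qed.

Lemma Rabs_ratio_minus (k m : nat) : Rabs ((/ 4 - centre k m) / node k m) <= ratio k m.
Proof.
unfold ratio, Rdiv; rewrite Rabs_mult, (Rabs_pos_eq (/ _)).
- apply Rmult_le_compat_r; [left; apply Rinv_0_lt_compat; pose proof (node_ge_1 k m); lra|].
  unfold centre; pose proof (INR_S_ge_1 m); pose proof (pos_INR k).
  rewrite Rabs_left; lra.
- left; apply Rinv_0_lt_compat; pose proof (node_ge_1 k m); lra.
Qed.

Lemma ratio_diff_le (k m j : nat) : Rabs (ratio_diff k m j) <= 2 * ratio k m ^ S j.
Proof.
unfold ratio_diff, Rminus; eapply Rle_trans; [apply Rabs_triang|].
change (/ 4 + - centre k m) with (/ 4 - centre k m).
rewrite Rabs_Ropp, <- !RPow_abs; fold (ratio k m).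
pose proof (ratio_pos k m); rewrite (Rabs_pos_eq (ratio k m)) by lra.
assert (Rabs ((/ 4 - centre k m) / node k m) ^ S j <= ratio k m ^ S j); [|lra].
apply pow_incr; split; [apply Rabs_pos|apply Rabs_ratio_minus].
Qed.

Lemma cbinom_reduced (w : C) (j : nat) :
  cbinom (1 - w) (S j) = ((1 - w) * reduced_binom w j)%C.
Proof.
induction j as [|j IH].
- simpl; field.
- change (cbinom (1 - w) (S (S j))) with
    (cbinom (1 - w) (S j) * (((1 - w) - RtoC (INR (S j))) / RtoC (INR (S (S j)))))%C.
  rewrite IH; cbn [reduced_binom]; rewrite (S_INR j), RtoC_plus.
  pose proof (RtoC_INR_S_neq_0 (S j)); field; assumption.
Qed.

(** Up to a constant factor the polynomial is w (w + 1) ... (w + j - 1). Its zeros are where the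
    shifted copies of F would have poles. *)
Lemma reduced_binom_zero (l j : nat) :
  (l < j)%nat -> reduced_binom (- RtoC (INR l))%C j = RtoC 0.
Proof.
induction j as [|j IH]; intros H; [lia|]; cbn [reduced_binom].
destruct (Nat.eq_dec l j) as [->|Hne].
- replace (- (- RtoC (INR j) + RtoC (INR j)))%C with (RtoC 0) by ring.
  field; apply RtoC_INR_S_neq_0.
- rewrite IH by lia; ring.
Qed.

Lemma wiener_reduced_binom (w0 : C) (r : R) (j : nat) :
  0 < r -> wiener (fun w => reduced_binom w j) w0 r (binom_majorant (Cmod w0 + r) j).
Proof.
intros Hr; pose proof (Cmod_ge_0 w0) as Hw0; induction j as [|j IH].
- apply wiener_le with (r := r) (B := Cmod (RtoC 1)); [lra|rewrite Cmod_1; simpl; lra|].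
  apply wiener_const.
- cbn [reduced_binom binom_majorant].
  apply wiener_mult; [lra|exact IH|].
  pose proof (pos_INR j); pose proof (INR_S_ge_1 j); pose proof (INR_S_ge_1 (S j)).
  apply wiener_ext with (fun w => - RtoC (/ INR (S (S j))) * (w + RtoC (INR j)))%C.
  { intros z _; rewrite RtoC_inv by lra; field; apply RtoC_INR_S_neq_0. }
  (* The denominator of [reduced_binom] is j + 2 and that of the majorant j + 1, so the majorant of
     [cbinom] serves here as well. *)
  apply wiener_le with (r := r)
    (B := Cmod (- RtoC (/ INR (S (S j))))%C * (Cmod w0 + r + Cmod (RtoC (INR j)))); [lra| |].
  + rewrite Cmod_opp, !Cmod_R, (Rabs_pos_eq (INR j)), Rabs_pos_eq, Rmult_comm
      by (try apply pos_INR; left; apply Rinv_0_lt_compat; lra).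
    apply Rmult_le_compat_l; [lra|].
    apply Rinv_le_contravar; [lra|rewrite (S_INR (S j)); lra].
  + apply wiener_scal, wiener_plus; [lra|apply wiener_id; lra|apply wiener_const].
Qed.

Lemma exp_ln_pow (x : R) (n : nat) : 0 < x -> exp (INR n * ln x) = x ^ n.
Proof. intros Hx; rewrite Rmult_comm; symmetry; rewrite <- Rpower_pow by exact Hx; unfold Rpower; f_equal; ring. Qed.

Lemma series_inv_sqr : exists l : R, is_series (fun m => / INR (S m) ^ 2) l.
Proof.
destruct (series_pos_bounded (fun m => / INR (S m) ^ 2) 2) as [l [Hl _]];
  [| |exists l; exact Hl].
- intros j; left; apply Rinv_0_lt_compat, pow_lt, lt_0_INR; lia.
- intros n; apply Rle_trans with (2 - / INR (S n)).
  + induction n as [|n IH]; [rewrite sum_n_OR; simpl; lra|].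
    rewrite sum_n_SR.
    enough (/ INR (S (S n)) ^ 2 <= / INR (S n) - / INR (S (S n))) by lra.
    pose proof (INR_S_ge_1 n) as H; rewrite (S_INR (S n)); set (x := INR (S n)) in *.
    replace (/ x - / (x + 1)) with (/ (x * (x + 1))) by (field; lra).
    apply Rinv_le_contravar; nra.
  + assert (0 < / INR (S n)) by (apply Rinv_0_lt_compat, lt_0_INR; lia); lra.
Qed.

(** The numbers 1/4 + y and 1/4 - y are the roots of X^2 = X / 2 + (y^2 - 1/16), so the differences
    D_j of their j-th powers satisfy D_(j+2) = D_(j+1) / 2 + (y^2 - 1/16) D_j. The factor is u +
    [kap], whence the degree in u grows by at most one in two steps. *)
Lemma shift_poly (k j : nat) :
  exists d : nat -> R, (forall i, (j < 2 * i)%nat -> d i = 0) /\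
    forall y u, y ^ 2 = u + (INR k / 2) ^ 2 ->
      (/ 4 + y) ^ S j - (/ 4 - y) ^ S j = 2 * y * sum_n (fun i => d i * u ^ i) j.
Proof.
set (kap := (INR k / 2) ^ 2 - / 16).
assert (Hext : forall (d : nat -> R) u n, d (S n) = 0 ->
  sum_n (fun i => d i * u ^ i) (S n) = sum_n (fun i => d i * u ^ i) n).
{ intros d u n H; rewrite sum_n_SR, H; eqR; ring. }
(* Two consecutive indices are carried through the induction because the recurrence has order
   two. *)
enough (H : (exists d : nat -> R, (forall i, (j < 2 * i)%nat -> d i = 0) /\
    forall y u, y ^ 2 = u + (INR k / 2) ^ 2 ->
      (/ 4 + y) ^ S j - (/ 4 - y) ^ S j = 2 * y * sum_n (fun i => d i * u ^ i) j) /\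
  (exists d : nat -> R, (forall i, (S j < 2 * i)%nat -> d i = 0) /\
    forall y u, y ^ 2 = u + (INR k / 2) ^ 2 ->
      (/ 4 + y) ^ S (S j) - (/ 4 - y) ^ S (S j) = 2 * y * sum_n (fun i => d i * u ^ i) (S j)))
  by apply H.
induction j as [|j [[d0 [Hs0 H0]] [d1 [Hs1 H1]]]].
- split.
  + exists (fun i => match i with O => 1 | S _ => 0 end); split.
    * intros [|i] Hi; [lia|reflexivity].
    * intros y u _; rewrite sum_n_OR; simpl; ring.
  + exists (fun i => match i with O => / 2 | S _ => 0 end); split.
    * intros [|i] Hi; [lia|reflexivity].
    * intros y u _; rewrite sum_n_SR, sum_n_OR; simpl; field.
- split; [exists d1; auto|].
  exists (fun i => / 2 * d1 i + kap * d0 i + match i with O => 0 | S i' => d0 i' end); split.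
  + intros i Hi; rewrite Hs1, Hs0 by lia; destruct i as [|i]; [lia|].
    rewrite Hs0 by lia; ring.
  + intros y u Hy.
    assert (Hsh : forall n, sum_n (fun i => match i with O => 0 | S i' => d0 i' end * u ^ i) (S n)
      = u * sum_n (fun i => d0 i * u ^ i) n).
    { induction n as [|n IH]; [rewrite sum_n_SR, !sum_n_OR; simpl; eqR; ring|].
      rewrite sum_n_SR, IH, (sum_n_SR _ n); simpl; eqR; ring. }
    assert (Hsum : forall n, sum_n (fun i => (/ 2 * d1 i + kap * d0 i
        + match i with O => 0 | S i' => d0 i' end) * u ^ i) n
      = / 2 * sum_n (fun i => d1 i * u ^ i) n + kap * sum_n (fun i => d0 i * u ^ i) n
        + sum_n (fun i => match i with O => 0 | S i' => d0 i' end * u ^ i) n).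
    { induction n as [|n IH]; [rewrite !sum_n_OR; eqR; ring|].
      rewrite !sum_n_SR, IH; eqR; ring. }
    rewrite Hsum, Hsh, (Hext d1), (Hext d0), (Hext d0) by (first [apply Hs1|apply Hs0]; lia).
    transitivity (/ 2 * ((/ 4 + y) ^ S (S j) - (/ 4 - y) ^ S (S j))
      + (y ^ 2 - / 16) * ((/ 4 + y) ^ S j - (/ 4 - y) ^ S j)).
    { simpl; field. }
    rewrite (H0 y u Hy), (H1 y u Hy), Hy.
    unfold kap; field.
Qed.

Lemma Re_ball (z z0 : C) (r : R) : Cmod (z - z0)%C <= r -> Rabs (Re z - Re z0) <= r.
Proof.
intros Hz; replace (Re z - Re z0) with (Re (z - z0)%C); [|unfold Cminus; rewrite re_plus, re_opp; ring].
eapply Rle_trans; [apply re_le_Cmod|exact Hz].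
Qed.

Lemma half_plane_ball (w0 z : C) (r s : R) :
  Cmod (z - w0)%C <= r -> s + r < Re w0 -> s < Re z.
Proof.
intros Hz Hs; apply Re_ball in Hz; apply Rabs_le_between in Hz; lra.
Qed.

Lemma Cexp_RtoC (x : R) : Cexp (RtoC x) = RtoC (exp x).
Proof.
unfold Cexp; simpl; rewrite cos_0, sin_0.
apply injective_projections; simpl; ring.
Qed.

Lemma Cmult_sum_n (c : C) (f : nat -> C) (n : nat) :
  (c * sum_n f n)%C = sum_n (fun i => c * f i)%C n.
Proof.
induction n as [|n IH]; [rewrite !sum_n_OC; reflexivity|].
rewrite !sum_n_SC, <- IH; ring.
Qed.

Lemma RtoC_sum_n (f : nat -> R) (n : nat) :
  RtoC (sum_n f n) = sum_n (fun i => RtoC (f i)) n.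
Proof.
induction n as [|n IH]; [rewrite sum_n_OC, sum_n_OR; reflexivity|].
rewrite sum_n_SC, sum_n_SR, <- IH, <- RtoC_plus; reflexivity.
Qed.

Lemma sum_n_ext_le (f g : nat -> C) (n : nat) :
  (forall i, (i <= n)%nat -> f i = g i) -> sum_n f n = sum_n g n.
Proof. intros H; exact (sum_n_ext_loc f g n H). Qed.

(** The exponents of u combine as (1 - w) - (j + 1) + i = - (w + (j - i)), so the monomial u^i
    contributes the base term shifted by j - i. *)
Lemma shift_term_poly (k j : nat) (d : nat -> R) :
  (forall y u, y ^ 2 = u + (INR k / 2) ^ 2 ->
    (/ 4 + y) ^ S j - (/ 4 - y) ^ S j = 2 * y * sum_n (fun i => d i * u ^ i) j) ->
  forall w m, shift_term k w m j
    = sum_n (fun i => RtoC (d i) * base_term k (w + RtoC (INR (j - i)))%C m)%C j.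
Proof.
intros Hd w m; unfold shift_term, ratio_diff, base_term.
pose proof (node_ge_1 k m) as Hu.
set (u := node k m) in *; set (y := centre k m).
replace (((/ 4 + y) / u) ^ S j - ((/ 4 - y) / u) ^ S j)
  with (2 * y * / u ^ S j * sum_n (fun i => d i * u ^ i) j).
- rewrite RtoC_mult, RtoC_sum_n, Cmult_assoc, Cmult_sum_n.
  apply sum_n_ext_le; intros i Hi.
  replace (Cexp ((1 - w) * RtoC (ln u)))
    with (Cexp (- (w + RtoC (INR (j - i))) * RtoC (ln u)) * RtoC (u ^ S (j - i)))%C.
  + assert (E : u ^ S (j - i) * / u ^ S j * u ^ i = 1).
    { replace (S j) with (S (j - i) + i)%nat by lia.
      rewrite pow_add; field; split; apply pow_nonzero; lra. }
    rewrite !RtoC_mult.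
    transitivity (Cexp (- (w + RtoC (INR (j - i))) * RtoC (ln u)) * RtoC (d i) * (RtoC 2 * RtoC y)
      * (RtoC (u ^ S (j - i)) * RtoC (/ u ^ S j) * RtoC (u ^ i)))%C; [ring|].
    rewrite <- (RtoC_mult (u ^ S (j - i))), <- (RtoC_mult (u ^ S (j - i) * _)), E; ring.
  + rewrite <- exp_ln_pow, <- Cexp_RtoC, <- Cexp_plus by lra.
    f_equal; rewrite RtoC_mult, S_INR, RtoC_plus; ring.
- unfold Rdiv; rewrite !Rpow_mult_distr, <- Rmult_minus_distr_r, (Hd y u).
  + rewrite pow_inv by lra; ring.
  + unfold y, u, node, centre; field.
Qed.

(** Both half-integer values of g are u (1 + t) with |t| < 1, and the binomial series of their
    powers are subtracted. The constant terms cancel, so the index j stands for the power j + 1; the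
    factor 1 - w of the remaining coefficients absorbs the division by w - 1, up to the sign that
    exchanges the two ratios. *)
Lemma binomial_step (k m : nat) (w : C) : (1 <= k)%nat -> w <> RtoC 1 ->
  is_cseries (fun j => reduced_binom w j * shift_term k w m j)%C
    ((Cexp ((1 - w) * RtoC (ln (half_node k m)))
      - Cexp ((1 - w) * RtoC (ln (half_node k (S m))))) / (w - 1))%C.
Proof.
intros Hk Hw; apply Cminus_neq_0 in Hw.
pose proof (ratio_le_78 k m Hk) as Hr; pose proof (ratio_pos k m) as Hr0.
pose proof (Rabs_ratio_minus k m) as Hrm; pose proof (node_ge_1 k m) as Hu.
set (tp := (/ 4 + centre k m) / node k m); fold tp in Hr, Hr0, Hrm.
change (ratio k m) with tp in Hr, Hr0, Hrm.
set (tm := (/ 4 - centre k m) / node k m) in *.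
assert (Hp : Rabs tp < 1) by (rewrite Rabs_pos_eq; lra).
assert (Hm : Rabs tm < 1) by lra.
pose proof (is_cseries_minus _ _ _ _ (Cexp_binomial (1 - w) tm Hm) (Cexp_binomial (1 - w) tp Hp)) as H.
apply (proj2 (is_cseries_S _ _)) in H; cbn beta in H.
apply Rabs_def2 in Hm; apply Rabs_def2 in Hp.
rewrite half_node_S, half_node_eq; fold tp tm.
rewrite !ln_mult, !RtoC_plus, !Cmult_plus_distr_l, !Cexp_plus by lra.
set (U := Cexp ((1 - w) * RtoC (ln (node k m)))) in *.
refine (eq_rect _ (fun l => is_cseries _ l) _ _ _).
- refine (is_cseries_ext _ _ _ _ (is_cseries_scal (U / (w - 1))%C _ _ H)).
  intros j; cbn beta; rewrite cbinom_reduced; unfold shift_term, ratio_diff; fold tp tm U.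
  rewrite RtoC_minus, !RtoC_pow; field; exact Hw.
- simpl; field; exact Hw.
Qed.

Lemma cseries_telescope (G : nat -> C) :
  (forall eps, 0 < eps -> exists N, forall n, (N <= n)%nat -> Cmod (G n) < eps) ->
  is_cseries (fun m => G m - G (S m))%C (G O).
Proof.
intros HG; apply is_cseries_eps; intros eps Heps.
destruct (HG eps Heps) as [N HN]; exists N; intros n Hn.
replace (sum_n (fun m => G m - G (S m))%C n - G O)%C with (- G (S n))%C.
- rewrite Cmod_opp; apply HN; lia.
- clear; induction n as [|n IH]; [rewrite sum_n_OC; ring|].
  rewrite sum_n_SC.
  transitivity (sum_n (fun m => G m - G (S m)) n - G O + (G (S n) - G (S (S n))))%C;
    [rewrite <- IH; ring|ring].
Qed.

Lemma half_node_power_limit (k : nat) (w : C) : 1 < Re w ->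
  forall eps, 0 < eps -> exists N, forall n, (N <= n)%nat ->
    Cmod (Cexp ((1 - w) * RtoC (ln (half_node k n)))) < eps.
Proof.
intros Hw eps Heps.
(* The modulus is g (n + 1/2)^(1 - Re w); it is below eps once ln g (n + 1/2) > - ln eps / (Re w -
   1), and g (n + 1/2) > n. *)
destruct (INR_unbounded (exp (- ln eps / (Re w - 1)))) as [N HN].
exists N; intros n Hn; rewrite Cmod_Cexp, re_scal_r.
unfold Cminus; rewrite re_plus, re_opp; simpl (Re (RtoC 1)).
rewrite <- (exp_ln eps Heps); apply exp_increasing.
assert (H : - ln eps / (Re w - 1) < ln (half_node k n)).
{ rewrite <- (ln_exp (- ln eps / (Re w - 1))); apply ln_increasing; [apply exp_pos|].
  eapply Rlt_le_trans; [exact HN|]; apply le_INR in Hn.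
  unfold half_node; pose proof (pos_INR n); pose proof (pos_INR k).
  assert (0 <= INR n * (INR n + INR k)) by (apply Rmult_le_pos; lra); nra. }
apply (Rmult_lt_compat_l (Re w - 1)) in H; [|lra].
replace ((Re w - 1) * (- ln eps / (Re w - 1))) with (- ln eps) in H by (field; lra).
lra.
Qed.

(** * Bounds for the tail of the expansion *)

Lemma wiener_shift_term (k m j : nat) (w0 : C) (r : R) : 0 <= r ->
  wiener (fun w => shift_term k w m j) w0 r
    (exp ((1 - Re w0 + r) * ln (node k m)) * (2 * ratio k m ^ S j)).
Proof.
intros Hr; pose proof (ln_node_nonneg k m) as HL; set (L := ln (node k m)) in *.
apply wiener_ext with
  (fun w => (RtoC (exp L) * RtoC (ratio_diff k m j)) * Cexp (w * RtoC (- L)))%C.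
{ intros w _; unfold shift_term; fold L; rewrite <- Cexp_RtoC.
  transitivity (Cexp (RtoC L) * Cexp (w * RtoC (- L)) * RtoC (ratio_diff k m j))%C; [ring|].
  rewrite <- Cexp_plus; do 2 f_equal; rewrite RtoC_opp; ring. }
apply wiener_le with (3 := wiener_scal _ _ _ _ _ (wiener_exp (- L) w0 r Hr)); [lra|].
rewrite Cmod_mult, !Cmod_R, Rabs_Ropp, (Rabs_pos_eq L), (Rabs_pos_eq (exp L))
  by (try assumption; left; apply exp_pos).
replace ((1 - Re w0 + r) * L) with (L + (Re w0 * - L + L * r)) by ring.
rewrite (exp_plus L).
pose proof (exp_pos L); pose proof (exp_pos (Re w0 * - L + L * r)).
rewrite (Rmult_comm (exp L)), Rmult_assoc, (Rmult_comm (exp L * _)).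
rewrite Rmult_comm, (Rmult_comm (2 * _)); apply Rmult_le_compat_l; [|].
- rewrite Rmult_comm; apply Rmult_le_pos; lra.
- apply ratio_diff_le.
Qed.

(** Of the powers of the ratio, J are kept to make the sum over m converge, and the others are
    bounded by powers of 7/8 to make the sum over j converge. The clause for every g lets the sum
    function be chosen independently of w0 and r. *)
Lemma tail_wiener (k J : nat) (w0 : C) (r : R) : (1 <= k)%nat -> 0 < r ->
  exists M, 0 <= M /\ forall m,
    (exists l, is_cseries (fun j => reduced_binom w0 (J + j) * shift_term k w0 m (J + j))%C l) /\
    forall g, (forall w, is_cseries
        (fun j => reduced_binom w (J + j) * shift_term k w m (J + j))%C (g w)) ->
      wiener g w0 r (exp ((1 - Re w0 + r) * ln (node k m)) * ratio k m ^ J * M).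
Proof.
intros Hk Hr; set (q := Cmod w0 + r).
assert (Hq : 0 < q) by (unfold q; pose proof (Cmod_ge_0 w0); lra).
assert (HM : exists M : R, is_series (fun j => binom_majorant q (J + j) * (7 / 8) ^ j) M).
{ destruct (binom_majorant_summable q (7 / 8) Hq ltac:(lra)) as [l Hl].
  destruct (proj1 (ex_series_incr_n (fun j => binom_majorant q j * (7 / 8) ^ j) J)) as [l' Hl'];
    [exists l; exact Hl|].
  exists (/ (7 / 8) ^ J * l').
  apply is_series_ext with (2 := is_series_scal (V := R_NormedModule) (/ (7 / 8) ^ J) _ _ Hl').
  intros n; change (/ (7 / 8) ^ J * (binom_majorant q (J + n) * (7 / 8) ^ (J + n))
    = binom_majorant q (J + n) * (7 / 8) ^ n).
  rewrite pow_add; field; apply pow_nonzero; lra. }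
destruct HM as [M HM].
assert (HM0 : 0 <= M).
{ eapply Rle_trans; [|apply (sum_n_le_series _ _ O) with (2 := HM)].
  - rewrite sum_n_OR; apply Rmult_le_pos; [left; apply binom_majorant_pos, Hq|apply pow_le; lra].
  - intros j; apply Rmult_le_pos; [left; apply binom_majorant_pos, Hq|apply pow_le; lra]. }
exists (2 * M); split; [lra|]; intros m.
set (A := exp ((1 - Re w0 + r) * ln (node k m))).
assert (HA : 0 < A) by apply exp_pos.
pose proof (ratio_pos k m) as Hrp; pose proof (ratio_le_78 k m Hk) as Hr8.
set (B := fun j => (A * ratio k m ^ J * 2) * (binom_majorant q (J + j) * (7 / 8) ^ j)).
assert (HB : is_series B (A * ratio k m ^ J * 2 * M))
  by exact (is_series_scal (V := R_NormedModule) (A * ratio k m ^ J * 2) _ _ HM).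
assert (Hw : forall j, wiener (fun w => reduced_binom w (J + j) * shift_term k w m (J + j))%C
  w0 r (B j)).
{ intros j.
  apply wiener_le with (3 := wiener_mult _ _ _ _ _ _ (Rlt_le _ _ Hr)
    (wiener_reduced_binom w0 r (J + j) Hr) (wiener_shift_term k m (J + j) w0 r (Rlt_le _ _ Hr)));
    [lra|].
  fold q A; unfold B.
  replace (A * ratio k m ^ J * 2 * (binom_majorant q (J + j) * (7 / 8) ^ j))
    with (binom_majorant q (J + j) * (A * (2 * (ratio k m ^ J * (7 / 8) ^ j)))) by ring.
  apply Rmult_le_compat_l; [left; apply binom_majorant_pos, Hq|].
  apply Rmult_le_compat_l; [lra|]; apply Rmult_le_compat_l; [lra|].
  replace (S (J + j)) with (J + S j)%nat by lia; rewrite pow_add.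
  apply Rmult_le_compat_l; [apply pow_le; lra|].
  apply Rle_trans with ((7 / 8) ^ S j); [apply pow_incr; lra|].
  simpl; rewrite <- (Rmult_1_l ((7 / 8) ^ j)) at 2.
  apply Rmult_le_compat_r; [apply pow_le; lra|lra]. }
split.
- destruct (cseries_dominated (fun j => reduced_binom w0 (J + j) * shift_term k w0 m (J + j))%C
    B (A * ratio k m ^ J * 2 * M)) as [l [Hl _]]; [|exact HB|exists l; exact Hl].
  intros j; apply (wiener_bound _ _ _ _ w0 (Hw j)), Cmod_self_le; lra.
- intros g Hg; replace (A * ratio k m ^ J * (2 * M)) with (A * ratio k m ^ J * 2 * M) by ring.
  apply wiener_sum with (2 := Hw) (3 := HB); [lra|intros z _; apply Hg].
Qed.

Lemma node_ratio_decay (k E m : nat) : (1 <= k)%nat ->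
  node k m ^ E * ratio k m ^ S (S (2 * E))
  <= (1 + INR k) ^ E * (INR k + 2) ^ S (S (2 * E)) * / INR (S m) ^ 2.
Proof.
intros Hk; pose proof (INR_S_ge_1 m); pose proof (pos_INR k).
pose proof (node_ge_1 k m); pose proof (ratio_pos k m).
set (J := S (S (2 * E))).
apply Rle_trans with (((1 + INR k) * INR (S m) ^ 2) ^ E * ((INR k + 2) / INR (S m)) ^ J).
- apply Rmult_le_compat; try (apply pow_le; lra); apply pow_incr;
    (split; [lra|]); [apply node_le|apply ratio_le].
- right; unfold Rdiv; rewrite !Rpow_mult_distr, pow_inv by lra.
  assert (E1 : INR (S m) ^ J = (INR (S m) ^ 2) ^ E * INR (S m) ^ 2).
  { rewrite <- pow_mult, <- pow_add; f_equal; unfold J; lia. }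
  rewrite E1; field; split; [|apply pow_nonzero]; try lra.
  apply pow_nonzero; lra.
Qed.

Lemma shift_tail (k E : nat) : (1 <= k)%nat ->
  exists (T : C -> nat -> C) (R : C -> C),
    (forall w m, is_cseries (fun j => reduced_binom w (S (S (2 * E)) + j)
      * shift_term k w m (S (S (2 * E)) + j))%C (T w m)) /\
    (forall w, 1 - INR E < Re w -> is_cseries (T w) (R w)) /\
    (forall w0, 1 - INR E < Re w0 -> analytic_at R w0).
Proof.
intros Hk; set (J := S (S (2 * E))).
assert (HT : forall p : C * nat, exists l, is_cseries (fun j => reduced_binom (fst p) (J + j)
      * shift_term k (fst p) (snd p) (J + j))%C l).
{ intros [w m]; destruct (tail_wiener k J w 1 Hk Rlt_0_1) as [M [_ HM]]; apply (HM m). }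
apply functional_choice in HT; destruct HT as [T0 HT].
set (T := fun w m => T0 (w, m)).
assert (HTw : forall w m, is_cseries (fun j => reduced_binom w (J + j)
      * shift_term k w m (J + j))%C (T w m)) by (intros w m; exact (HT (w, m))).
destruct series_inv_sqr as [sq Hsq].
assert (Hb : forall w0, 1 - INR E < Re w0 -> exists B0,
  forall m, wiener (fun w => T w m) w0 ((INR E - 1 + Re w0) / 2) (B0 * / INR (S m) ^ 2)).
(* This r is half the distance from w0 to the line Re w = 1 - E, so 1 - Re w0 + r <= E. *)
{ intros w0 Hw0; set (r := (INR E - 1 + Re w0) / 2).
  assert (Hr : 0 < r) by (unfold r; lra).
  destruct (tail_wiener k J w0 r Hk Hr) as [M [HM0 HM]].
  exists ((1 + INR k) ^ E * (INR k + 2) ^ J * M); intros m.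
  destruct (HM m) as [_ Hg].
  apply wiener_le with (3 := Hg (fun w => T w m) (fun w => HTw w m)); [lra|].
  pose proof (node_ratio_decay k E m Hk) as Hdec; fold J in Hdec.
  apply Rle_trans with (node k m ^ E * ratio k m ^ J * M).
  - apply Rmult_le_compat_r; [exact HM0|].
    apply Rmult_le_compat_r; [apply pow_le; pose proof (ratio_pos k m); lra|].
    rewrite <- exp_ln_pow by (pose proof (node_ge_1 k m); lra).
    assert (Hle : (1 - Re w0 + r) * ln (node k m) <= INR E * ln (node k m))
      by (apply Rmult_le_compat_r; [apply ln_node_nonneg|unfold r; lra]).
    destruct Hle as [Hlt|Heq]; [left; apply exp_increasing; exact Hlt|rewrite Heq; lra].
  - apply (Rmult_le_compat_r M) in Hdec; [|exact HM0].
    eapply Rle_trans; [exact Hdec|right; ring]. }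
(* Off the half-plane the function gets the default value 0; the discs used below stay inside the
   half-plane. *)
assert (HR : forall w, exists l, 1 - INR E < Re w -> is_cseries (T w) l).
{ intros w; destruct (Rlt_dec (1 - INR E) (Re w)) as [Hw|Hw]; [|exists (RtoC 0); intros; lra].
  destruct (Hb w Hw) as [B0 HB].
  destruct (cseries_dominated (T w) (fun m => B0 * / INR (S m) ^ 2) (B0 * sq)) as [l [Hl _]].
  - intros m; apply (wiener_bound _ _ _ _ w (HB m)), Cmod_self_le; lra.
  - exact (is_series_scal (V := R_NormedModule) B0 _ _ Hsq).
  - exists l; auto. }
apply functional_choice in HR; destruct HR as [R HR].
exists T, R; split; [exact HTw|split; [exact HR|]].
intros w0 Hw0; destruct (Hb w0 Hw0) as [B0 HB].
exists ((INR E - 1 + Re w0) / 2), (B0 * sq); split; [lra|].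
apply wiener_sum with (2 := HB).
- lra.
- exact (is_series_scal (V := R_NormedModule) B0 _ _ Hsq).
- intros z Hz; apply HR, (half_plane_ball w0 z _ _ Hz); lra.
Qed.

(** * Continuation strip by strip *)

Definition residue_at_1 (z0 : C) : C := if Ceq_dec z0 (RtoC 1) then RtoC 1 else RtoC 0.

(** A crude estimate: 2 y <= (2 + k) n and |u^(-w)| <= u^(-2) <= n^(-4) on the disc. Convergence for
    1 < Re w comes out of the continuation step, so the start may be confined to Re w > 2. *)
Lemma wiener_base_term (k m : nat) (w0 : C) (r : R) : 0 <= r -> r + 2 <= Re w0 ->
  wiener (fun w => base_term k w m) w0 r ((2 + INR k) * / INR (S m) ^ 2).
Proof.
intros Hr Hw0; pose proof (ln_node_nonneg k m) as HL; pose proof (node_ge_1 k m) as Hu.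
pose proof (INR_S_ge_1 m) as Hn; pose proof (pos_INR k) as Hk; pose proof (node_ge_sqr k m) as Hs.
set (L := ln (node k m)) in *.
apply wiener_ext with (fun w => RtoC (2 * centre k m) * Cexp (w * RtoC (- L)))%C.
{ intros w _; unfold base_term; fold L; do 2 f_equal; rewrite RtoC_opp; ring. }
apply wiener_le with (3 := wiener_scal _ _ _ _ _ (wiener_exp (- L) w0 r Hr)); [lra|].
rewrite Cmod_R, Rabs_Ropp, (Rabs_pos_eq L), Rabs_pos_eq by (unfold centre; lra).
apply Rle_trans with ((2 + INR k) * INR (S m) * / (INR (S m) ^ 2) ^ 2).
- apply Rmult_le_compat; [unfold centre; lra|left; apply exp_pos| |].
  + unfold centre; assert (0 <= INR k * (INR (S m) - 1)) by (apply Rmult_le_pos; lra); lra.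
  + apply Rle_trans with (/ node k m ^ 2).
    * rewrite <- (exp_ln_pow _ 2), <- exp_Ropp by lra; fold L.
      assert (Hle : Re w0 * - L + L * r <= - (INR 2 * L)) by (simpl; nra).
      destruct Hle as [Hlt|Heq]; [left; apply exp_increasing; exact Hlt|rewrite Heq; lra].
    * apply Rinv_le_contravar; [apply pow_lt, pow_lt; lra|].
      apply pow_incr; split; [apply pow_le; lra|exact Hs].
- rewrite Rmult_assoc; apply Rmult_le_compat_l; [lra|].
  replace (INR (S m) * / (INR (S m) ^ 2) ^ 2) with (/ INR (S m) ^ 2 * / INR (S m))
    by (field; lra).
  rewrite <- (Rmult_1_r (/ INR (S m) ^ 2)) at 2; apply Rmult_le_compat_l.
  + left; apply Rinv_0_lt_compat, pow_lt; lra.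
  + rewrite <- Rinv_1; apply Rinv_le_contravar; lra.
Qed.

Lemma base_series (k : nat) :
  exists F : C -> C, (forall w, 2 < Re w -> is_cseries (base_term k w) (F w)) /\
    forall w0, 2 < Re w0 -> analytic_at F w0.
Proof.
destruct series_inv_sqr as [sq Hsq].
pose proof (is_series_scal (V := R_NormedModule) (2 + INR k) _ _ Hsq) as HB.
assert (HF : forall w, exists l, 2 < Re w -> is_cseries (base_term k w) l).
{ intros w; destruct (Rlt_dec 2 (Re w)) as [Hw|Hw]; [|exists (RtoC 0); intros; lra].
  destruct (cseries_dominated (base_term k w) (fun m => (2 + INR k) * / INR (S m) ^ 2)
    ((2 + INR k) * sq)) as [l [Hl _]]; [|exact HB|exists l; auto].
  intros m; apply (wiener_bound _ _ _ _ w (wiener_base_term k m w 0 ltac:(lra) ltac:(lra))).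
  apply Cmod_self_le; lra. }
apply functional_choice in HF; destruct HF as [F HF]; exists F; split; [exact HF|].
intros w0 Hw0; exists ((Re w0 - 2) / 2), ((2 + INR k) * sq); split; [lra|].
apply wiener_sum with (3 := HB) (f := fun m w => base_term k w m).
- lra.
- intros m; apply wiener_base_term; lra.
- intros z Hz; apply HF, (half_plane_ball w0 z _ 2 Hz); lra.
Qed.

(** For the monomials with vanishing coefficient, whose shifted argument may lie outside the
    half-plane where the series is known to converge. *)
Lemma is_cseries_scal_0 (c : C) (a : nat -> C) (l : C) :
  c = RtoC 0 -> is_cseries (fun n => c * a n)%C (c * l)%C.
Proof.
intros ->; rewrite Cmult_0_l; apply is_cseries_ext with (2 := is_cseries_0); intros n; ring.
Qed.

(** The contributing values of F have arguments shifted by at least 1, so knowledge for Re > 2 - N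
    yields knowledge for Re > 1 - N. The telescoped identity is summed term by term, hence the new
    function is again the sum of the series, now for 1 < Re w. *)
Lemma continuation_step (k N : nat) (F : C -> C) : (1 <= k)%nat ->
  (forall w, 2 < Re w -> is_cseries (base_term k w) (F w)) ->
  (forall w0, 2 - INR N < Re w0 -> at_most_simple_pole F w0 (residue_at_1 w0)) ->
  exists F' : C -> C,
    (forall w, 1 < Re w -> is_cseries (base_term k w) (F' w)) /\
    (forall w0, 1 - INR N < Re w0 -> at_most_simple_pole F' w0 (residue_at_1 w0)).
Proof.
intros Hk HF HP.
destruct (functional_choice _ (shift_poly k)) as [d Hd].
assert (Hd0 : forall j i, (j < 2 * i)%nat -> d j i = 0) by (intros j; apply Hd).
assert (Hpoly : forall j w m, shift_term k w m j
  = sum_n (fun i => RtoC (d j i) * base_term k (w + RtoC (INR (j - i)))%C m)%C j)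
  by (intros j; apply shift_term_poly, Hd).
(* At power 1 the polynomial is the constant 1, so the leading term of the expansion is the base
   term itself; the value is read off at y = 1. *)
assert (Hd00 : d O O = 1).
{ pose proof (proj2 (Hd O) 1 (1 - (INR k / 2) ^ 2) ltac:(ring)) as H.
  rewrite sum_n_OR in H; simpl in H; lra. }
clear Hd.
destruct (shift_tail k N Hk) as [T [Tl [HT [HTl HTa]]]].
set (G := fun w m => Cexp ((1 - w) * RtoC (ln (half_node k m)))).
set (mid := fun w j => (reduced_binom w (S j)
  * sum_n (fun i => RtoC (d (S j) i) * F (w + RtoC (INR (S j - i)))%C) (S j))%C).
exists (fun w => G w O / (w - 1) + - 1 * (sum_n (mid w) (2 * N) + Tl w))%C; split.
- intros w Hw.
  assert (Hw1 : w <> RtoC 1) by (intros ->; simpl in Hw; lra).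
  assert (H1 : is_cseries (fun m => (G w m - G w (S m)) / (w - 1))%C (G w O / (w - 1))%C).
  { unfold Cdiv; rewrite Cmult_comm.
    refine (is_cseries_ext _ _ _ _ (is_cseries_scal (/ (w - 1))%C _ _
      (cseries_telescope (G w) (half_node_power_limit k w Hw)))).
    intros n; ring. }
  assert (H2 : is_cseries (fun m => sum_n (fun j => reduced_binom w (S j)
      * shift_term k w m (S j))%C (2 * N)) (sum_n (mid w) (2 * N))).
  { apply is_cseries_sum_n; intros j _; apply is_cseries_scal.
    refine (is_cseries_ext _ _ _ (fun m => eq_sym (Hpoly (S j) w m)) _).
    (* Either the shift S j - i is at least 1 or the coefficient is 0; this degree bound excludes an
       unshifted F on the right-hand side. *)
    apply is_cseries_sum_n; intros i Hi; destruct (Nat.le_gt_cases (2 * i) (S j)) as [Hle|Hlt].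
    - apply is_cseries_scal, HF; rewrite re_plus, Re_RtoC.
      assert (1 <= INR (S j - i)) by (apply (le_INR 1); lia); lra.
    - apply is_cseries_scal_0; rewrite Hd0 by exact Hlt; reflexivity. }
  assert (H3 : is_cseries (T w) (Tl w)) by (apply HTl; pose proof (pos_INR N); lra).
  refine (eq_rect _ (fun l => is_cseries _ l) (is_cseries_ext _ _ _ _
    (is_cseries_minus _ _ _ _ H1 (is_cseries_plus _ _ _ _ H2 H3))) _ _); [|ring].
  intros m; cbn beta.
  pose proof (binomial_step k m w Hk Hw1) as HB.
  (* Removing the indices up to 2 N + 1 leaves the series that defines [T w m]; [E0] then splits off
     the index 0, which is the base term. *)
  apply (proj2 (is_cseries_shift _ _ (S (2 * N)))) in HB.
  pose proof (is_cseries_unique _ _ _ HB (HT w m)) as E.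
  fold (G w m) (G w (S m)) in E; rewrite <- E.
  assert (E0 : forall (f : nat -> C) n, sum_n f (S n) = (f O + sum_n (fun j => f (S j)) n)%C).
  { intros f; induction n as [|n IH]; [rewrite sum_n_SC, !sum_n_OC; reflexivity|].
    rewrite sum_n_SC, IH, sum_n_SC; eqC; ring. }
  rewrite E0, (Hpoly O), sum_n_OC; simpl (0 - 0)%nat.
  rewrite Hd00; simpl (reduced_binom w 0); simpl INR; rewrite Cplus_0_r; ring.
- intros w0 Hw0.
  assert (HG : analytic_at (fun w => G w O) w0).
  { apply analytic_ext with (fun w => Cexp (RtoC (ln (half_node k 0)))
      * Cexp (w * RtoC (- ln (half_node k 0))))%C.
    - intros w; rewrite <- Cexp_plus; unfold G; f_equal; rewrite RtoC_opp; ring.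
    - apply analytic_mult; [apply analytic_const|apply analytic_exp]. }
  assert (HA : at_most_simple_pole (fun w => G w O / (w - 1))%C w0 (residue_at_1 w0)).
  { unfold residue_at_1; destruct (Ceq_dec w0 (RtoC 1)) as [->|Hne].
    (* At w = 1 the numerator is g (1/2)^0 = 1, which is the residue. *)
    - refine (eq_rect _ (at_most_simple_pole _ (RtoC 1)) (simple_pole_div _ _ HG) _ _).
      unfold G; replace ((1 - 1) * RtoC (ln (half_node k 0)))%C with (RtoC 0) by ring.
      rewrite Cexp_RtoC, exp_0; reflexivity.
    - apply simple_pole_analytic, analytic_mult; [exact HG|apply analytic_inv, Hne]. }
  assert (HM : at_most_simple_pole (fun w => sum_n (mid w) (2 * N)) w0 (RtoC 0)).
  { assert (Hz : forall n, sum_n (fun _ : nat => RtoC 0) n = RtoC 0).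
    { induction n as [|n IH]; [apply sum_n_OC|rewrite sum_n_SC, IH; eqC; ring]. }
    rewrite <- (Hz (2 * N)%nat).
    apply (simple_pole_sum_n (fun j w => mid w j) w0 (fun _ => RtoC 0)); intros j _; unfold mid.
    rewrite <- (Hz (S j)).
    apply simple_pole_near with (fun w => sum_n (fun i => reduced_binom w (S j)
      * (RtoC (d (S j) i) * F (w + RtoC (INR (S j - i)))%C))%C (S j)).
    { apply punctured_all; intros w; symmetry; apply Cmult_sum_n. }
    apply (simple_pole_sum_n (fun i w => reduced_binom w (S j)
      * (RtoC (d (S j) i) * F (w + RtoC (INR (S j - i))))) w0 (fun _ => RtoC 0))%C; intros i Hi.
    destruct (Nat.le_gt_cases (2 * i) (S j)) as [Hle|Hlt].
    - assert (Hl : 1 <= INR (S j - i)) by (apply (le_INR 1); lia).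
      assert (HPF : at_most_simple_pole F (w0 + RtoC (INR (S j - i)))%C
        (residue_at_1 (w0 + RtoC (INR (S j - i)))%C)).
      { apply HP; rewrite re_plus, Re_RtoC; lra. }
      apply simple_pole_shift in HPF.
      apply (simple_pole_mult (fun _ => RtoC (d (S j) i)) _ _ _ (analytic_const _ _)) in HPF.
      apply (simple_pole_mult (fun w => reduced_binom w (S j))) in HPF.
      + replace (RtoC 0) with (reduced_binom w0 (S j) * (RtoC (d (S j) i)
          * residue_at_1 (w0 + RtoC (INR (S j - i)))))%C; [exact HPF|].
        (* A pole occurs only for w0 = 1 - (S j - i) = - (S j - i - 1), and since S j - i - 1 < S j
           this is a zero of [reduced_binom]. *)
        unfold residue_at_1; destruct (Ceq_dec _ _) as [E|_]; [|ring].
        replace w0 with (- RtoC (INR (S j - i - 1)))%C; [rewrite reduced_binom_zero by lia; ring|].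
        rewrite minus_INR, RtoC_minus by lia; simpl (INR 1); rewrite <- E; ring.
      + eexists 1, _; split; [lra|apply wiener_reduced_binom; lra].
    - apply simple_pole_near with (2 := simple_pole_analytic _ _ (analytic_const (RtoC 0) w0)).
      apply punctured_all; intros w; rewrite Hd0 by exact Hlt; ring. }
  pose proof (simple_pole_plus _ _ _ _ _ HM (simple_pole_analytic _ _ (HTa w0 Hw0))) as H.
  apply (simple_pole_mult (fun _ => - 1)%C _ _ _ (analytic_const _ _)) in H.
  pose proof (simple_pole_plus _ _ _ _ _ HA H) as H'.
  replace (residue_at_1 w0) with (residue_at_1 w0 + - 1 * (0 + 0))%C by ring; exact H'.
Qed.

(** The induction asks for convergence only on 2 < Re w: at N = 0 this half-plane misses the pole at
    1, and [base_series] suffices. One last step brings convergence to 1 < Re w. *)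
Lemma half_plane_continuation (k N : nat) : (1 <= k)%nat ->
  exists F : C -> C,
    (forall w, 1 < Re w -> is_cseries (base_term k w) (F w)) /\
    (forall w0, 1 - INR N < Re w0 -> at_most_simple_pole F w0 (residue_at_1 w0)).
Proof.
intros Hk.
assert (H : exists F : C -> C,
    (forall w, 2 < Re w -> is_cseries (base_term k w) (F w)) /\
    (forall w0, 2 - INR N < Re w0 -> at_most_simple_pole F w0 (residue_at_1 w0))).
{ induction N as [|N [F [HF HP]]].
  - destruct (base_series k) as [F [HF HP]]; exists F; split; [exact HF|].
    intros w0 Hw0; simpl INR in Hw0; unfold residue_at_1.
    destruct (Ceq_dec w0 (RtoC 1)) as [->|_]; [rewrite Re_RtoC in Hw0; lra|].
    apply simple_pole_analytic, HP; lra.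
  - destruct (continuation_step k N F Hk HF HP) as [F' [HF' HP']].
    exists F'; split; [intros w Hw; apply HF'; lra|].
    intros w0 Hw0; apply HP'; rewrite S_INR in Hw0; lra. }
destruct H as [F [HF HP]]; exact (continuation_step k N F Hk HF HP).
Qed.

Lemma meromorphic_unique (f g : C -> C) (z0 : C) (K : R) :
  (forall z, Re z0 <= Re z -> meromorphic_at f z) ->
  (forall z, Re z0 <= Re z -> meromorphic_at g z) ->
  (forall z, K < Re z -> f z = g z) ->
  punctured z0 (fun z => f z = g z).
Proof.
intros Hf Hg HK; destruct z0 as [x0 y].
apply punctured_imp with (fun z => (f z - g z)%C = RtoC 0).
{ intros z _ H; replace (f z) with (f z - g z + g z)%C by ring; rewrite H; ring. }
apply (meromorphic_identity (fun z => f z - g z)%C x0 y K).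
- intros x Hx; apply meromorphic_minus; [apply Hf|apply Hg]; exact Hx.
- intros x Hx; exists ((x - K) / 2); split; [lra|]; intros z [_ Hz].
  rewrite HK; [ring|].
  apply (half_plane_ball (x, y) z ((x - K) / 2) K); [lra|simpl; lra].
Qed.

Lemma punctured_bounded_forall (z0 : C) (M : nat) (P : nat -> C -> Prop) :
  (forall n, (n <= M)%nat -> punctured z0 (P n)) ->
  punctured z0 (fun z => forall n, (n <= M)%nat -> P n z).
Proof.
induction M as [|M IH]; intros H.
- apply punctured_imp with (2 := H O (Nat.le_refl 0)).
  intros z _ Hz n Hn; replace n with O by lia; exact Hz.
- apply punctured_imp with (2 := punctured_and _ _ _ (IH (fun n Hn => H n ltac:(lia)))
    (H (S M) (Nat.le_refl _))).
  intros z _ [H1 H2] n Hn; destruct (Nat.eq_dec n (S M)) as [->|Hne]; [exact H2|].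
  apply H1; lia.
Qed.

(** The strips are glued by using at w a level that grows with |Re w|. Near w0 only finitely many
    levels occur, so one punctured disc serves for all the agreements between them. *)
Lemma base_continuation (k : nat) : (1 <= k)%nat ->
  exists F : C -> C,
    (forall w, 1 < Re w -> is_cseries (base_term k w) (F w)) /\
    (forall w0, at_most_simple_pole F w0 (residue_at_1 w0)).
Proof.
intros Hk.
destruct (functional_choice _ (fun N => half_plane_continuation k N Hk)) as [F HF].
assert (Hlev : forall w : C, exists n : nat, Rabs (Re w) + 2 < INR n <= Rabs (Re w) + 4).
{ intros w; destruct (nfloor_ex (Rabs (Re w) + 3)) as [n Hn].
  - pose proof (Rabs_pos (Re w)); lra.
  - exists (S n); rewrite S_INR; lra. }
apply functional_choice in Hlev; destruct Hlev as [lev Hlev].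
exists (fun w => F (lev w) w); split; [intros w Hw; apply HF, Hw|].
intros w0.
(* For |w - w0| <= 1 the level of w is at most |Re w0| + 5 < M, and it exceeds |Re w0| + 1, so that
   1 - lev w < Re w0. *)
destruct (INR_unbounded (Rabs (Re w0) + 5)) as [M HM].
assert (Hagree : punctured w0 (fun w => forall n, (n <= M)%nat ->
  1 - INR n < Re w0 -> F M w = F n w)).
{ apply punctured_bounded_forall; intros n Hn.
  destruct (Rlt_dec (1 - INR n) (Re w0)) as [Hlt|Hge];
    [|apply punctured_all; intros w Hlt; lra].
  assert (H : punctured w0 (fun w => F M w = F n w)).
  { apply meromorphic_unique with (K := 1).
    - intros z Hz; apply (meromorphic_simple_pole _ _ (residue_at_1 z)), HF.
      apply le_INR in Hn; lra.
    - intros z Hz; apply (meromorphic_simple_pole _ _ (residue_at_1 z)), HF; lra.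
    - intros z Hz; apply (is_cseries_unique (base_term k z)); apply HF, Hz. }
  apply punctured_imp with (2 := H); auto. }
apply simple_pole_near with (F M).
- assert (Hball : punctured w0 (fun w => Cmod (w - w0)%C <= 1)).
  { exists 1; split; [lra|intros z Hz; lra]. }
  apply punctured_imp with (2 := punctured_and _ _ _ Hagree Hball).
  intros w _ [H1 H2]; apply Re_ball in H2; specialize (Hlev w).
  assert (H3 : Rabs (Rabs (Re w) - Rabs (Re w0)) <= 1)
    by (eapply Rle_trans; [apply Rabs_triang_inv2|exact H2]).
  apply Rabs_le_between in H3.
  apply H1; [apply INR_le; lra|].
  pose proof (Rle_abs (- Re w0)) as H4; rewrite Rabs_Ropp in H4; lra.
- apply HF; pose proof (Rle_abs (- Re w0)) as H4; rewrite Rabs_Ropp in H4; lra.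
Qed.

(** * The zeta function *)

Lemma cpowR_node (k m : nat) (s : C) :
  (cpowR (INR (S m)) s * cpowR (INR (S m) + INR k) s)%C = Cexp (s * RtoC (ln (node k m))).
Proof.
unfold cpowR, node; pose proof (INR_S_ge_1 m); pose proof (pos_INR k).
rewrite <- Cexp_plus, ln_mult, RtoC_plus by lra; f_equal; ring.
Qed.

Lemma Cexp_opp (z : C) : (Cexp (- z) * Cexp z)%C = RtoC 1.
Proof.
rewrite <- Cexp_plus; replace (- z + z)%C with (RtoC 0) by ring.
rewrite Cexp_RtoC, exp_0; reflexivity.
Qed.

Lemma Cexp_neq_0 (z : C) : Cexp z <> RtoC 0.
Proof. apply Cmod_gt_0; rewrite Cmod_Cexp; apply exp_pos. Qed.

Lemma Cinv_Cexp (z : C) : (/ Cexp z)%C = Cexp (- z).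
Proof.
pose proof (Cexp_neq_0 z).
transitivity (Cexp (- z) * Cexp z * / Cexp z)%C; [rewrite Cexp_opp; ring|field; assumption].
Qed.

Lemma sum_f_R0_sum_n (f : nat -> R) (n : nat) : sum_f_R0 f n = sum_n f n.
Proof. symmetry; apply sum_n_Reals. Qed.

Lemma zeta_term_eq (k : nat) (a : nat -> R) (s : C) (m : nat) :
  is_CP_coeffs k a ->
  zeta_CP_term k s m = (RtoC (INR k / INR (fact (k - 1)) ^ 2)
    * sum_n (fun l => RtoC (a l) * base_term k (s + - RtoC (INR l))%C m) (k - 1))%C.
Proof.
intros Ha; unfold zeta_CP_term, Cdiv; rewrite cpowR_node, Cinv_Cexp.
unfold Q; rewrite Ha, sum_f_R0_sum_n.
pose proof (INR_fact_neq_0 (k - 1)) as Hf.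
pose proof (node_ge_1 k m) as Hu.
replace (INR (S m) ^ 2 + INR k * INR (S m)) with (node k m) by (unfold node; ring).
replace (INR k * (2 * INR (S m) + INR k) / INR (fact (k - 1)) ^ 2)
  with (INR k / INR (fact (k - 1)) ^ 2 * (2 * centre k m)) by (unfold centre; field; exact Hf).
rewrite !RtoC_mult, RtoC_sum_n, <- !Cmult_assoc; f_equal.
rewrite (Cmult_comm (sum_n _ _)), !Cmult_assoc, Cmult_sum_n; apply sum_n_ext_le; intros l _.
unfold base_term; rewrite !RtoC_mult, <- exp_ln_pow, <- Cexp_RtoC by lra.
replace (Cexp (- (s + - RtoC (INR l)) * RtoC (ln (node k m))))
  with (Cexp (- (s * RtoC (ln (node k m)))) * Cexp (RtoC (INR l * ln (node k m))))%C.
- ring.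
- rewrite <- Cexp_plus, RtoC_mult; f_equal; ring.
Qed.

(** The residue is recorded at every s0 in one formula; the summand of index l is nonzero at most
    for s0 = l + 1. *)
Lemma zeta_CP_continuation (k : nat) (a : nat -> R) : (1 <= k)%nat -> is_CP_coeffs k a ->
  exists Z : C -> C,
    (forall s, INR k < Re s -> exists S, is_cseries (zeta_CP_term k s) S /\
      Z s = (1 / cpowR 4 s * S)%C) /\
    (forall s0, at_most_simple_pole Z s0
      (1 / cpowR 4 s0 * (RtoC (INR k / INR (fact (k - 1)) ^ 2)
        * sum_n (fun l => RtoC (a l) * residue_at_1 (s0 + - RtoC (INR l))) (k - 1)))%C).
Proof.
intros Hk Ha; destruct (base_continuation k Hk) as [F [HF HP]].
set (K := RtoC (INR k / INR (fact (k - 1)) ^ 2)).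
exists (fun s => 1 / cpowR 4 s
  * (K * sum_n (fun l => RtoC (a l) * F (s + - RtoC (INR l))) (k - 1)))%C; split.
- intros s Hs; eexists; split; [|reflexivity].
  apply is_cseries_ext with (1 := fun m => eq_sym (zeta_term_eq k a s m Ha)).
  apply is_cseries_scal, is_cseries_sum_n; intros l Hl.
  apply is_cseries_scal, HF; rewrite re_plus, re_opp, Re_RtoC.
  assert (H : INR l <= INR (k - 1)) by (apply le_INR, Hl).
  rewrite minus_INR in H by exact Hk; simpl (INR 1) in H; lra.
- intros s0.
  apply (simple_pole_mult (fun s => 1 / cpowR 4 s)%C).
  { apply analytic_ext with (fun s => Cexp (s * RtoC (- ln 4))); [|apply analytic_exp].
    intros z; unfold cpowR, Cdiv; rewrite Cinv_Cexp, RtoC_opp, Cmult_1_l; f_equal; ring. }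
  apply (simple_pole_mult (fun _ => K)); [apply analytic_const|].
  apply (simple_pole_sum_n (fun l s => RtoC (a l) * F (s + - RtoC (INR l)))%C s0
    (fun l => RtoC (a l) * residue_at_1 (s0 + - RtoC (INR l)))%C); intros l _.
  apply (simple_pole_mult (fun _ => RtoC (a l))); [apply analytic_const|].
  apply simple_pole_shift, HP.
Qed.

Lemma residue_sum (a : nat -> R) (n k : nat) : (1 <= n <= k)%nat ->
  sum_n (fun l => RtoC (a l) * residue_at_1 (RtoC (INR n) + - RtoC (INR l)))%C (k - 1)
  = RtoC (a (n - 1)%nat).
Proof.
intros Hn.
assert (Hterm : forall l, residue_at_1 (RtoC (INR n) + - RtoC (INR l))%C
  = if Nat.eq_dec l (n - 1) then RtoC 1 else RtoC 0).
{ intros l; unfold residue_at_1; rewrite <- RtoC_opp, <- RtoC_plus.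
  destruct (Nat.eq_dec l (n - 1)) as [->|Hne].
  - destruct (Ceq_dec _ _) as [_|E]; [reflexivity|exfalso; apply E].
    rewrite minus_INR by lia; simpl (INR 1); f_equal; ring.
  - destruct (Ceq_dec _ _) as [E|_]; [|reflexivity].
    exfalso; apply RtoC_inj in E; apply Hne; apply INR_eq.
    rewrite minus_INR by lia; simpl (INR 1); lra. }
assert (H : forall M, sum_n (fun l => RtoC (a l)
    * residue_at_1 (RtoC (INR n) + - RtoC (INR l)))%C M
  = if le_dec (n - 1) M then RtoC (a (n - 1)%nat) else RtoC 0).
{ induction M as [|M IH].
  - rewrite sum_n_OC, Hterm; destruct (Nat.eq_dec 0 (n - 1)) as [E|E];
      destruct (le_dec (n - 1) 0); try lia; [rewrite <- E; eqC; ring|eqC; ring].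
  - rewrite sum_n_SC, IH, Hterm; destruct (Nat.eq_dec (S M) (n - 1)) as [E|E];
      destruct (le_dec (n - 1) M); destruct (le_dec (n - 1) (S M)); try lia;
      try rewrite <- E; eqC; ring. }
rewrite H; destruct (le_dec (n - 1) (k - 1)); [reflexivity|lia].
Qed.

Lemma cpowR_4_INR (n : nat) : cpowR 4 (RtoC (INR n)) = RtoC (4 ^ n).
Proof.
unfold cpowR; rewrite <- RtoC_mult, Cexp_RtoC, exp_ln_pow by lra; reflexivity.
Qed.

(** * Positivity of the coefficients *)

Lemma positive_shift_product (cs : list R) : (forall c, In c cs -> 0 < c) ->
  exists e : nat -> R, (forall l, (l <= length cs)%nat -> 0 < e l) /\
    (forall l, (length cs < l)%nat -> e l = 0) /\
    forall y, fold_right Rmult 1 (map (fun c => y + c) cs)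
      = sum_f_R0 (fun l => e l * y ^ l) (length cs).
Proof.
induction cs as [|c cs IH]; intros Hc.
- exists (fun l => match l with O => 1 | S _ => 0 end); split; [|split].
  + intros [|l] Hl; [lra|simpl in Hl; lia].
  + intros [|l] Hl; [simpl in Hl; lia|reflexivity].
  + intros y; simpl; ring.
- destruct IH as [e [He [Hz Hy]]]; [intros x Hx; apply Hc; right; exact Hx|].
  assert (Hc0 : 0 < c) by (apply Hc; left; reflexivity).
  (* [e] lists the elementary symmetric functions of the positive numbers in the list. Its values 0
     beyond the length make the recurrence e_(l-1) + c e_l valid for the top coefficient too. *)
  exists (fun l => match l with O => c * e O | S i => e i + c * e (S i) end).
  split; [|split].
  + intros [|l] Hl; simpl in Hl.
    * apply Rmult_lt_0_compat; [exact Hc0|apply He; lia].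
    * assert (0 < e l) by (apply He; lia).
      assert (0 <= e (S l)); [|assert (0 <= c * e (S l)) by (apply Rmult_le_pos; lra); lra].
      destruct (le_lt_dec (S l) (length cs)) as [Hle|Hlt];
        [left; apply He, Hle|rewrite Hz by exact Hlt; lra].
  + intros [|l] Hl; simpl in Hl; [lia|].
    rewrite (Hz l), (Hz (S l)) by lia; ring.
  + intros y; cbn [map fold_right length]; rewrite Hy.
    assert (H : forall M, sum_f_R0 (fun l => match l with O => c * e O
        | S i => e i + c * e (S i) end * y ^ l) (S M)
      = (y + c) * sum_f_R0 (fun l => e l * y ^ l) M + c * e (S M) * y ^ S M).
    { induction M as [|M IHM]; [simpl; ring|].
      rewrite tech5, IHM, (tech5 _ M); simpl; ring. }
    rewrite H, (Hz (S (length cs))) by lia; ring.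
Qed.

(** Letting y tend to 0 from above gives the constant coefficient; the others follow after division
    by y. Positive y are the right domain because each of them is x^2 + k x for a real x. *)
Lemma poly_zero_coeffs (n : nat) : forall c : nat -> R,
  (forall y, 0 < y -> sum_f_R0 (fun l => c l * y ^ l) n = 0) ->
  forall l, (l <= n)%nat -> c l = 0.
Proof.
assert (Hsplit : forall n (c : nat -> R) y, sum_f_R0 (fun l => c l * y ^ l) (S n)
  = c O + y * sum_f_R0 (fun l => c (S l) * y ^ l) n).
{ induction n0 as [|m IHm]; intros c y; [simpl; ring|].
  rewrite tech5, IHm, (tech5 _ m); simpl; ring. }
induction n as [|n IH]; intros c Hc l Hl.
- replace l with O by lia; specialize (Hc 1 Rlt_0_1); simpl in Hc; lra.
- assert (Hb : forall m (b : nat -> R), exists M, 0 < M /\ forall y, 0 < y <= 1 ->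
    Rabs (sum_f_R0 (fun l => b l * y ^ l) m) <= M).
  { induction m as [|m IHm]; intros b.
    - exists (Rabs (b O) + 1); split; [pose proof (Rabs_pos (b O)); lra|].
      intros y _; simpl; rewrite Rmult_1_r; lra.
    - destruct (IHm (fun l => b (S l))) as [M [HM HMy]].
      exists (Rabs (b O) + M); split; [pose proof (Rabs_pos (b O)); lra|].
      intros y Hy; rewrite Hsplit; eapply Rle_trans; [apply Rabs_triang|].
      apply Rplus_le_compat_l; rewrite Rabs_mult, (Rabs_pos_eq y) by lra.
      specialize (HMy y Hy); rewrite <- (Rmult_1_l M).
      apply Rmult_le_compat; [lra|apply Rabs_pos|lra|exact HMy]. }
  assert (H0 : c O = 0).
  { destruct (Req_dec (c O) 0) as [E|E]; [exact E|exfalso].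
    apply Rabs_pos_lt in E; destruct (Hb n (fun l => c (S l))) as [M [HM HMy]].
    (* With this y the remaining sum, bounded by M on (0, 1], contributes at most |c_0| / 2 and
       cannot cancel c_0. *)
    set (y := Rmin 1 (Rabs (c O) / (2 * M))).
    assert (Hy : 0 < y <= 1).
    { split; [apply Rmin_glb_lt; [lra|apply Rdiv_lt_0_compat; lra]|apply Rmin_l]. }
    specialize (HMy y Hy); specialize (Hc y (proj1 Hy)); rewrite Hsplit in Hc.
    assert (Hc0 : Rabs (c O) = y * Rabs (sum_f_R0 (fun l => c (S l) * y ^ l) n)).
    { rewrite <- (Rabs_pos_eq y) at 1 by lra; rewrite <- Rabs_mult, <- Rabs_Ropp.
      f_equal; lra. }
    assert (H1 : y * Rabs (sum_f_R0 (fun l => c (S l) * y ^ l) n) <= Rabs (c O) / (2 * M) * M).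
    { apply Rmult_le_compat; [lra|apply Rabs_pos|apply Rmin_r|exact HMy]. }
    replace (Rabs (c O) / (2 * M) * M) with (Rabs (c O) / 2) in H1 by (field; lra); lra. }
  destruct l as [|l]; [exact H0|].
  apply (IH (fun l => c (S l))); [|lia]; intros y Hy.
  specialize (Hc y Hy); rewrite Hsplit, H0 in Hc.
  apply Rmult_eq_reg_l with y; lra.
Qed.

Lemma prod_below_mult (k : nat) (f g : nat -> R) :
  prod_below k (fun i => f i * g i) = prod_below k f * prod_below k g.
Proof.
unfold prod_below; induction (seq 1 (k - 1)) as [|i s IH]; simpl; [ring|rewrite IH; ring].
Qed.

Lemma prod_below_reflect (k : nat) (f : nat -> R) :
  prod_below k (fun i => f (k - i)%nat) = prod_below k f.
Proof.
unfold prod_below; rewrite <- (map_map (fun i => (k - i)%nat) f).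
assert (Hperm : forall s t : list R, Permutation s t ->
  fold_right Rmult 1 s = fold_right Rmult 1 t)
  by (intros s t H; induction H; simpl; try lra; congruence).
apply Hperm, Permutation_map, NoDup_Permutation_bis.
- apply NoDup_map_NoDup_ForallPairs; [|apply seq_NoDup].
  intros i j Hi Hj; apply in_seq in Hi; apply in_seq in Hj; lia.
- rewrite length_map; lia.
- intros j Hj; apply in_map_iff in Hj; destruct Hj as [i [<- Hi]].
  apply in_seq in Hi; apply in_seq; lia.
Qed.

(** The two copies of the product are multiplied with one of them read backwards, so that x + i
    meets x + (k - i). *)
Lemma prod_below_sqr (k : nat) (x : R) :
  prod_below k (fun i => (x + INR i) ^ 2)
  = fold_right Rmult 1 (map (fun c => x ^ 2 + INR k * x + c)
      (map (fun i => INR i * INR (k - i)) (seq 1 (k - 1)))).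
Proof.
rewrite map_map.
transitivity (prod_below k (fun i => x + INR i) * prod_below k (fun i => x + INR i)).
- rewrite <- prod_below_mult; unfold prod_below; f_equal; apply map_ext; intros i; ring.
- rewrite <- (prod_below_reflect k (fun i => x + INR i)) at 2.
  rewrite <- prod_below_mult; unfold prod_below; f_equal; apply map_ext_in; intros i Hi.
  apply in_seq in Hi; rewrite minus_INR by lia; ring.
Qed.

(** The given [a] is identified with the positive coefficients of the expanded product: the two
    polynomials agree at every y > 0, because x^2 + k x = y has a real root x. *)
Lemma CP_coeffs_positive (k : nat) (a : nat -> R) : (1 <= k)%nat -> is_CP_coeffs k a ->
  forall l, (l <= k - 1)%nat -> 0 < a l.
Proof.
intros Hk Ha.
destruct (positive_shift_product (map (fun i => INR i * INR (k - i)) (seq 1 (k - 1))))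
  as [e [He [_ Hprod]]].
{ intros c Hc; apply in_map_iff in Hc; destruct Hc as [i [<- Hi]]; apply in_seq in Hi.
  apply Rmult_lt_0_compat; apply lt_0_INR; lia. }
rewrite length_map, length_seq in He, Hprod.
intros l Hl; enough (Heq : a l - e l = 0) by (specialize (He l Hl); lra).
apply (poly_zero_coeffs (k - 1) (fun l => a l - e l)); [|exact Hl]; intros y Hy.
assert (Hx : exists x, x ^ 2 + INR k * x = y).
{ assert (Hs : 0 <= INR k ^ 2 + 4 * y) by (pose proof (pow2_ge_0 (INR k)); lra).
  exists ((- INR k + sqrt (INR k ^ 2 + 4 * y)) / 2).
  pose proof (sqrt_sqrt _ Hs); nra. }
destruct Hx as [x <-].
assert (Hsub : forall m z, sum_f_R0 (fun l => (a l - e l) * z ^ l) m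
  = sum_f_R0 (fun l => a l * z ^ l) m - sum_f_R0 (fun l => e l * z ^ l) m).
{ induction m as [|m IH]; intros z; [simpl; ring|rewrite !tech5, IH; ring]. }
rewrite Hsub, <- Ha, <- Hprod, prod_below_sqr; ring.
Qed.

Theorem proposition3 (k : nat) (hk : (1 <= k)%nat)
  (a : nat -> R) (ha : is_CP_coeffs k a) :
  (exists zeta : C -> C, is_zeta_CP k zeta) /\
  (forall zeta : C -> C, is_zeta_CP k zeta ->
   forall n : nat, (1 <= n <= k)%nat ->
     simple_pole zeta (RtoC (INR n)) /\
     is_residue zeta (RtoC (INR n))
       (RtoC (1 / 4 ^ n * (INR k / (INR (fact (k - 1))) ^ 2) * a (n - 1)%nat))).
Proof.
destruct (zeta_CP_continuation k a hk ha) as [Z [HZ HP]]; split.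
- exists Z; split; [|exact HZ].
  intros z0; destruct (meromorphic_simple_pole _ _ _ (HP z0)) as [N [g [Hg Hf]]].
  destruct (laurent_of_analytic _ _ _ _ Hg Hf) as [c [Hc _]]; exists N, c; exact Hc.
- intros zeta [Hmer Hser] n Hn.
  (* Poles and residues depend only on the values near n and off n, so agreement on a punctured disc
     transfers them from [Z] to the given continuation. *)
  assert (Heq : punctured (RtoC (INR n)) (fun z => Z z = zeta z)).
  { apply meromorphic_unique with (K := INR k).
    - intros z _; exact (meromorphic_simple_pole _ _ _ (HP z)).
    - intros z _; destruct (Hmer z) as [N [c Hc]]; exact (meromorphic_of_laurent _ _ _ _ Hc).
    - intros z Hz; destruct (HZ z Hz) as [S1 [HS1 ->]]; destruct (Hser z Hz) as [S2 [HS2 ->]].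
      rewrite (is_cseries_unique _ _ _ HS1 HS2); reflexivity. }
  pose proof (simple_pole_near _ _ _ _ Heq (HP (RtoC (INR n)))) as H.
  rewrite residue_sum, cpowR_4_INR in H by exact Hn.
  assert (H4 : 0 < 4 ^ n) by (apply pow_lt; lra).
  replace (1 / RtoC (4 ^ n) * (RtoC (INR k / INR (fact (k - 1)) ^ 2) * RtoC (a (n - 1)%nat)))%C
    with (RtoC (1 / 4 ^ n * (INR k / (INR (fact (k - 1))) ^ 2) * a (n - 1)%nat)) in H
    by (rewrite <- RtoC_div by lra; rewrite !RtoC_mult; ring).
  destruct H as [g [Hg [Hg0 Hf]]].
  assert (Hf1 : punctured (RtoC (INR n)) (fun z => zeta z = g z / (z - RtoC (INR n)) ^ 1)%C).
  { apply punctured_imp with (2 := Hf); intros z _ ->; rewrite Cpow_1_r; reflexivity. }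
  destruct (laurent_of_analytic _ _ _ _ Hg Hf1) as [c [Hc Hc0]]; rewrite Hg0 in Hc0.
  split.
  + exists c; split; [exact Hc|]; rewrite Hc0; intros E; apply RtoC_inj in E.
    revert E; apply Rgt_not_eq.
    assert (0 < a (n - 1)%nat) by (apply (CP_coeffs_positive k a hk ha); lia).
    pose proof (INR_k_ge_1 k hk); pose proof (INR_fact_lt_0 (k - 1)).
    apply Rmult_lt_0_compat; [|assumption]; apply Rmult_lt_0_compat.
    * apply Rdiv_lt_0_compat; lra.
    * apply Rdiv_lt_0_compat; [lra|apply pow_lt; assumption].
  (* The order is S 0 = 1, so the coefficient with index 0 in [c] belongs to the power -1. *)
  + exists 0%nat, c; split; [exact Hc|exact Hc0].
Qed.
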